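(* Let $\mathcal{H}$ be a complex Hilbert space and $T\in\mathcal{B}(\mathcal{H})$. If $T$ is similar to an isometry, or $T$ is a quasi-isometry, then $T$ has a minimal $2$-isometric lifting of type I on the space $\ell_+^2(\mathcal{H})$ (identified with $\ell_+^2(\mathcal{H})\oplus\mathcal{H}$). Such a lifting is the operator $S_{A_\beta,T}$ (respectively $S_{T^*T,T}$), having covariance $\|A_\beta\|^{1/2}$ (respectively $\|T\|$). Here, when $T$ is similar to an isometry, $A$ is a positive operator on $\mathcal{H}$ and $\beta>0$ a scalar with $T^*AT=A\ge\beta I$, and $A_\beta=\beta^{-1}A$.
   Context: All Hilbert spaces are complex and operators are bounded and linear. $\Delta_T=T^*T-I$. $T$ is a quasi-isometry if $T^*(T^*T)T=T^*T$. $S$ is a $2$-isometry if $S^{*2}S^2-2S^*S+I=0$, with covariance ${\rm cov}(S)=\|\Delta_S\|^{1/2}$. If $\mathcal{H}$ is a closed subspace of $\mathcal{K}$, $S\in\mathcal{B}(\mathcal{K})$ is a lifting of $T\in\mathcal{B}(\mathcal{H})$ if $P_{\mathcal{H}}S=TP_{\mathcal{H}}$; it is minimal if $\mathcal{K}=\bigvee_{n\ge0}S^n\mathcal{H}$. A $2$-isometric lifting $S$ of $T$ is of type I if $\mathcal{K}\ominus\mathcal{H}\subset\mathcal{N}(\Delta_S)$ (equivalently, $S|_{\mathcal{K}\ominus\mathcal{H}}$ is an isometry). An operator $T$ is similar to an isometry exactly when $T^*AT=A$ for some $A\ge\beta I$, $\beta>0$. For $A\ge0$ with $T^*AT=A$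 and $A\ge\Delta_T$, put $A_T=A-\Delta_T\geq 0$. The operator $S_{A,T}$ is defined on $\ell_+^2(\overline{\mathcal{R}(A_T)})\oplus\mathcal{H}$ by $$S_{A,T}=\begin{pmatrix}S_+&JA_T^{1/2}\\0&T\end{pmatrix},$$ where $S_+$ is the forward shift on $\ell_+^2(\overline{\mathcal{R}(A_T)})$ and $J$ is the canonical injection of $\overline{\mathcal{R}(A_T)}$ into $\ell_+^2(\overline{\mathcal{R}(A_T)})$ as the zeroth coordinate. $\ell^2_+(\mathcal{L})$ is the space of square summable sequences $(x_n)_{n\ge0}$ in $\mathcal{L}$. *)

(* Defs.v *)
From HB Require Import structures.
From mathcomp Require Import all_boot all_order all_algebra.
From mathcomp Require Import all_classical all_reals all_analysis.
From mathcomp Require Import complex.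
From mathcomp Require Import ring lra.

Set Implicit Arguments.
Unset Strict Implicit.
Unset Printing Implicit Defensive.

Import Order.TTheory GRing.Theory Num.Theory Num.Def.
Import numFieldNormedType.Exports.
Local Open Scope classical_set_scope.
Local Open Scope ring_scope.
Local Open Scope complex_scope.

Section DotReal.
Variables (R : realType) (U : lmodType R[i]) (f : {dot U for conjC}).
Local Notation q x := (complex.Re (f x x)).
Local Notation r x y := (complex.Re (f x y)).

Lemma dot_diagE x : f x x = (q x)%:C.
Proof.
have := dnorm_ge0 f x; rewrite lecE /= => /andP[/eqP h _].
by apply/eqP; rewrite eq_complex /= eqxx h eqxx.
Qed.

Lemma dot_diag_ge0 x : 0 <= q x.
Proof. by have := dnorm_ge0 f x; rewrite lecE => /andP[]. Qed.

Lemma dot_diag_eq0 x : q x = 0 -> x = 0.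
Proof.
by move=> h; apply/eqP; rewrite -(dnorm_eq0 f) dot_diagE h.
Qed.

Lemma dot_conj x y : f x y = (f y x)^*.
Proof. by rewrite hermC expr0 mul1r. Qed.

Lemma dot_ReC x y : r x y = r y x.
Proof. by rewrite dot_conj; case: (f y x). Qed.

Lemma dot_diagZ (a : R) x : q (a%:C *: x) = a ^+ 2 * q x.
Proof.
rewrite dnormZ dot_diagE -[in LHS]add_Re2_Im2 /= expr0n /= addr0.
by rewrite mul0r subr0.
Qed.

Lemma dot_diagZC (a : R[i]) x : (q (a *: x))%:C = `|a| ^+ 2 * (q x)%:C.
Proof. by rewrite -!dot_diagE dnormZ. Qed.

Lemma dot_ReZ (a : R) x y : r (a%:C *: x) y = a * r x y.
Proof.
by rewrite linearZl_LR /=; case: (f x y) => u v /=; rewrite mul0r subr0.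
Qed.

Lemma dot_diagD x y : q (x + y) = q x + q y + 2 * r x y.
Proof.
rewrite dnormD; case: (f x y) => u v; rewrite /=.
by case: (f x x) => ? ?; case: (f y y) => ? ? /=; ring.
Qed.

Lemma dot_diagB x y : q (x - y) = q x + q y - 2 * r x y.
Proof.
rewrite dot_diagD -scaleN1r; have -> : (-1 : R[i]) = (-1)%:C by rewrite rmorphN1.
by rewrite dot_diagZ (dot_ReC x) dot_ReZ (dot_ReC y); ring.
Qed.

Lemma dot_Re_le x y : r x y <= Num.sqrt (q x) * Num.sqrt (q y).
Proof.
set s := Num.sqrt (q x); set t := Num.sqrt (q y).
have s0 : 0 <= s by apply: sqrtr_ge0.
have t0 : 0 <= t by apply: sqrtr_ge0.
have hs : q x = s ^+ 2 by rewrite sqr_sqrtr ?dot_diag_ge0.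
have ht : q y = t ^+ 2 by rewrite sqr_sqrtr ?dot_diag_ge0.
have [x0|xN0] := eqVneq s 0.
  have -> : x = 0 by apply: dot_diag_eq0; rewrite hs x0 expr0n.
  by rewrite linear0l /= x0 mul0r.
have [y0|yN0] := eqVneq t 0.
  have -> : y = 0 by apply: dot_diag_eq0; rewrite ht y0 expr0n.
  by rewrite linear0r /= y0 mulr0.
have st : 0 < s * t by rewrite mulr_gt0 // lt_def ?xN0 ?yN0.
have := dot_diag_ge0 (t%:C *: x - s%:C *: y).
rewrite dot_diagB !dot_diagZ hs ht dot_ReZ dot_ReC dot_ReZ (dot_ReC y) => h.
have : s * t * r x y <= s * t * (s * t) by lra.
by rewrite ler_pM2l.
Qed.

Lemma dot_triangle x y :
  Num.sqrt (q (x + y)) <= Num.sqrt (q x) + Num.sqrt (q y).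
Proof.
have h : 0 <= Num.sqrt (q x) + Num.sqrt (q y) by rewrite addr_ge0 ?sqrtr_ge0.
rewrite -[leRHS](ger0_norm h) -sqrtr_sqr ler_wsqrtr //.
rewrite dot_diagD sqrrD !sqr_sqrtr ?dot_diag_ge0 //.
by have := dot_Re_le x y; lra.
Qed.

End DotReal.

HB.mixin Record CompleteNormedModule_isHilbert (R : realType) H
    & CompleteNormedModule R[i] H := {
  hdot : {dot H for conjC};
  hdot_norm : forall x : H, `|x| ^+ 2 = hdot x x }.

#[short(type="hilbertType")]
HB.structure Definition Hilbert (R : realType) :=
  {H of CompleteNormedModule R[i] H & CompleteNormedModule_isHilbert R H}.

(* Hilbert space from an inner product for which Cauchy sequences converge. *)
HB.factory Record Lmodule_isHilbert (R : realType) H & GRing.Lmodule R[i] H := {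
  dot : {dot H for conjC};
  dot_complete : forall u : nat -> H,
    (forall e : R, 0 < e -> exists N, forall m n, (N <= m)%N -> (N <= n)%N ->
       complex.Re (dot (u m - u n) (u m - u n)) < e) ->
    exists l, forall e : R, 0 < e -> exists N, forall n, (N <= n)%N ->
       complex.Re (dot (u n - l) (u n - l)) < e }.

HB.builders Context R H & Lmodule_isHilbert R H.

Let nrm (x : H) : R := Num.sqrt (complex.Re (dot x x)).
Let norm (x : H) : R[i] := (nrm x)%:C.

Let norm_triangle x y : norm (x + y) <= norm x + norm y.
Proof. by rewrite /norm -rmorphD lecR; exact: dot_triangle. Qed.

Let normZ (l : R[i]) x : norm (l *: x) = `|l| * norm x.
Proof.
have n0 y : 0 <= norm y by rewrite lecR sqrtr_ge0.
apply/eqP; rewrite -(@eqrXn2 _ 2) ?mulr_ge0 //.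
have sqE y : norm y ^+ 2 = (complex.Re (dot y y))%:C.
  by rewrite -rmorphXn sqr_sqrtr ?dot_diag_ge0.
by rewrite exprMn !sqE dot_diagZC.
Qed.

Let norm_eq0 x : norm x = 0 -> x = 0.
Proof.
move=> /eqP; rewrite /norm fmorph_eq0 sqrtr_eq0 => h.
by apply: (@dot_diag_eq0 _ _ dot); apply/eqP; rewrite eq_le h dot_diag_ge0.
Qed.

HB.instance Definition _ := Lmodule_isNormed.Build R[i] H
  norm_triangle normZ norm_eq0.

Let normE (x : H) : `|x| = (nrm x)%:C. Proof. by []. Qed.

Let nrm_lt (x : H) (e : R) : 0 < e -> complex.Re (dot x x) < e ^+ 2 -> nrm x < e.
Proof.
move=> e0 h; rewrite -[ltRHS]ger0_norm ?ltW // -sqrtr_sqr ltr_sqrt //.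
by rewrite exprn_gt0.
Qed.

Let nrm_lt2 (x : H) (e : R) : nrm x < e -> complex.Re (dot x x) < e ^+ 2.
Proof.
by move=> h; rewrite -[ltLHS]sqr_sqrtr ?dot_diag_ge0 // ltrXn2r // ?sqrtr_ge0.
Qed.

Let nrmB (x y : H) : nrm (x - y) = nrm (y - x).
Proof.
by have := distrC x y; rewrite !normE => /(congr1 (@complex.Re R)).
Qed.

Let nrm_tri (x y z : H) : nrm (x - z) <= nrm (x - y) + nrm (y - z).
Proof.
have -> : x - z = (x - y) + (y - z) by rewrite addrA subrK.
exact: dot_triangle.
Qed.

Let real_eps (e : R[i]) : 0 < e -> e = (complex.Re e)%:C /\ 0 < complex.Re e.
Proof.
case: e => a b; rewrite ltcE /= => /andP[/eqP -> h].
by split.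
Qed.

Let complete (F : set_system H) : ProperFilter F -> cauchy F -> cvg F.
Proof.
move=> FF cF0; have cF : cauchy_ex F := (cauchyP F).1 cF0.
have d0 n : 0 < n.+1%:R^-1 :> R by rewrite invr_gt0 ltr0n.
have h n : exists x : H, F (ball x (n.+1%:R^-1 : R)%:C).
  by apply: cF; rewrite ltcR.
have [u hu] := choice h.
have inv_lt (e : R) : 0 < e -> exists N, forall n, (N <= n)%N -> n.+1%:R^-1 < e.
  move=> e0; exists (Num.truncn e^-1) => n Nn.
  rewrite -[ltRHS]invrK ltf_pV2 ?posrE ?invr_gt0 ?ltr0n //.
  rewrite (lt_le_trans (truncnS_gt _)) ?ler_nat //; exact: num_real.
have ubnd m n : nrm (u m - u n) < m.+1%:R^-1 + n.+1%:R^-1.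
  have [y [ym yn]] := filter_ex (filterI (hu m) (hu n)).
  move: ym yn; rewrite -!ball_normE /= !normE !ltcR => ym yn.
  rewrite (le_lt_trans (nrm_tri _ y _)) // (nrmB y).
  exact: ltrD.
have [] := dot_complete (u := u).
  move=> e e0; have s0 : 0 < Num.sqrt e by rewrite sqrtr_gt0.
  have [N hN] := inv_lt (Num.sqrt e / 2) (divr_gt0 s0 (ltr0n _ 2)).
  exists N => m n Nm Nn.
  rewrite -[ltRHS]sqr_sqrtr ?ltW //; apply: nrm_lt2.
  rewrite (lt_trans (ubnd _ _)) // [ltRHS]splitr.
  by apply: ltrD; apply: hN.
move=> l hl; apply/cvg_ex; exists l.
apply/cvg_ballP => e e0; have [-> {}e0] := real_eps e0.
set d := complex.Re e in e0 *.
have d2 : 0 < d / 2 by rewrite divr_gt0.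
have [N1 hN1] := hl _ (exprn_gt0 2 d2).
have [N2 hN2] := inv_lt _ d2.
set n := maxn N1 N2.
have {}hN1 := nrm_lt d2 (hN1 n (leq_maxl _ _)).
have {}hN2 := hN2 n (leq_maxr _ _).
apply: (filterS _ (hu n)) => y; rewrite -!ball_normE /= !normE !ltcR => yn.
rewrite (le_lt_trans (nrm_tri _ (u n) _)) // (nrmB l) [ltRHS]splitr.
by apply: ltrD => //; apply: lt_trans hN2.
Qed.

HB.instance Definition _ := Uniform_isComplete.Build H complete.

Let dot_norm (x : H) : `|x| ^+ 2 = dot x x.
Proof.
by rewrite normE -rmorphXn /= sqr_sqrtr ?dot_diag_ge0 // dot_diagE.
Qed.

HB.instance Definition _ := CompleteNormedModule_isHilbert.Build R H dot_norm.
HB.end.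

Section HilbertTheory.
Variables (R : realType) (H : hilbertType R).
Implicit Types x y : H.

(* The library norm of a complex normed module takes its values in R[i]. *)
Definition hnorm x : R := complex.Re `|x|.

Lemma normE_hnorm x : `|x| = (hnorm x)%:C.
Proof. by rewrite /hnorm RRe_real // ger0_real. Qed.

Lemma hnorm_sqr x : hnorm x ^+ 2 = complex.Re (hdot x x).
Proof. by rewrite -hdot_norm normE_hnorm -rmorphXn /=. Qed.

Lemma hnorm_ge0 x : 0 <= hnorm x.
Proof. rewrite -lecR -normE_hnorm; exact: normr_ge0. Qed.

Lemma hnorm0 : hnorm 0 = 0. Proof. by rewrite /hnorm normr0. Qed.

Lemma hnormN x : hnorm (- x) = hnorm x. Proof. by rewrite /hnorm normrN. Qed.

Lemma ler_hnormD x y : hnorm (x + y) <= hnorm x + hnorm y.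
Proof. by have := ler_normD x y; rewrite !normE_hnorm -rmorphD lecR. Qed.

Lemma hnormZ (a : R[i]) x : hnorm (a *: x) = complex.Re `|a| * hnorm x.
Proof.
rewrite /hnorm normrZ [`|x|]normE_hnorm /=.
by case: `|a| => u v /=; rewrite mulr0 subr0.
Qed.

Lemma hnormB_le x y : `|hnorm x - hnorm y| <= hnorm (x - y).
Proof.
rewrite ler_norml; apply/andP; split.
  have := ler_hnormD (y - x) x; rewrite subrK -opprB hnormN; lra.
by have := ler_hnormD (x - y) y; rewrite subrK; lra.
Qed.

Lemma cvg_hnorm (u : nat -> H) (l : H) :
  (fun n => hnorm (u n - l)) @ \oo --> (0 : R) -> u @ \oo --> l.
Proof.
move=> /cvgrPdist_lt h; apply/cvgrPdist_lt => -[a b].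
rewrite ltcE /= => /andP[/eqP -> a0]; have := h _ a0.
apply: filterS => n; rewrite normE_hnorm ltcR sub0r normrN.
by rewrite ger0_norm ?hnorm_ge0 // -hnormN opprB.
Qed.

Lemma hilbert_cauchy (u : nat -> H) :
  (forall e : R, 0 < e -> exists N, forall m n, (N <= m)%N -> (N <= n)%N ->
     hnorm (u m - u n) < e) ->
  exists l, (fun n => hnorm (u n - l)) @ \oo --> (0 : R).
Proof.
move=> h.
have /cauchy_cvg /cvg_ex [l hl] : cauchy (u @ \oo).
  apply/cauchyP => e; case: e => a b; rewrite ltcE /= => /andP[/eqP -> a0].
  have [N hN] := h _ a0; exists (u N); exists N => // n /= Nn.
  by rewrite -ball_normE /= normE_hnorm ltcR hN.
exists l; apply/cvgrPdist_lt => e e0.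
have e0' : 0 < e%:C by rewrite ltcR.
move/cvgrPdist_lt : hl => /(_ _ e0'); apply: filterS => n.
by rewrite normE_hnorm ltcR sub0r normrN ger0_norm ?hnorm_ge0 // -hnormN opprB.
Qed.

Lemma Re_hdot_le x y : complex.Re (hdot x y) <= hnorm x * hnorm y.
Proof.
apply: le_trans (dot_Re_le hdot x y) _.
by rewrite -!hnorm_sqr !sqrtr_sqr !ger0_norm ?hnorm_ge0.
Qed.

End HilbertTheory.

(* An inner product is linear in its first argument. *)
Section MkDot.
Variables (R : realType) (U : lmodType R[i]) (f : U -> U -> R[i]).
Hypothesis fl : forall a x y z, f (a *: x + y) z = a * f x z + f y z.
Hypothesis fC : forall x y, f x y = conjC (f y x).
Hypothesis fp : forall x, x != 0 -> 0 < f x x.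

Let fbil : bilinear_for *%R (conjC \; *%R) f.
Proof.
split=> [z a x y|z a x y]; first exact: fl.
change (f z (a *: x + y) = conjC a * f z x + f z y).
by rewrite (fC _ (_ + _)) fl rmorphD rmorphM (fC z x) (fC z y).
Qed.

Let fherm x y : f x y = (-1) ^+ false * conjC (f y x).
Proof. by rewrite expr0 mul1r -fC. Qed.

Definition mk_dot : {dot U for conjC} :=
  HB.pack f (bilinear_isBilinear.Build _ _ _ _ _ _ f fbil)
    (isHermitianSesquilinear.Build _ _ _ _ f fherm)
    (isDotProduct.Build _ _ f fp).

End MkDot.

Section DirectSum.
Variables (R : realType) (H1 H2 : hilbertType R).

(* The orthogonal direct sum; the product type itself has the sup norm. *)
Definition hsum : Type := (H1 * H2)%type.

HB.instance Definition _ := GRing.Lmodule.copy hsum (H1 * H2)%type.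

Definition hsum_form (x y : hsum) : R[i] := hdot x.1 y.1 + hdot x.2 y.2.

Fact hsum_form_linear a x y z :
  hsum_form (a *: x + y) z = a * hsum_form x z + hsum_form y z.
Proof. by rewrite /hsum_form /= !linearDl !linearZl_LR mulrDr addrACA. Qed.

Fact hsum_form_conj x y : hsum_form x y = conjC (hsum_form y x).
Proof. by rewrite /hsum_form rmorphD (dot_conj _ x.1) (dot_conj _ x.2). Qed.

Fact hsum_form_gt0 x : x != 0 -> 0 < hsum_form x x.
Proof.
case: x => x y; rewrite /hsum_form /= => h.
rewrite lt_def addr_ge0 ?dnorm_ge0 // andbT.
rewrite paddr_eq0 ?dnorm_ge0 // !dnorm_eq0; apply: contra h.
by move=> /andP[/eqP -> /eqP ->].
Qed.

Definition hsum_dot := mk_dot hsum_form_linear hsum_form_conj hsum_form_gt0.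

Fact hsum_complete (u : nat -> hsum) :
  (forall e : R, 0 < e -> exists N, forall m n, (N <= m)%N -> (N <= n)%N ->
     complex.Re (hsum_dot (u m - u n) (u m - u n)) < e) ->
  exists l, forall e : R, 0 < e -> exists N, forall n, (N <= n)%N ->
     complex.Re (hsum_dot (u n - l) (u n - l)) < e.
Proof.
have dE (x : hsum) : complex.Re (hsum_dot x x) = hnorm x.1 ^+ 2 + hnorm x.2 ^+ 2.
  by rewrite !hnorm_sqr /= /hsum_form; case: (hdot _ _); case: (hdot _ _).
move=> h; have h' (e : R) : 0 < e -> exists N, forall m n, (N <= m)%N ->
    (N <= n)%N -> hnorm ((u m).1 - (u n).1) < e /\ hnorm ((u m).2 - (u n).2) < e.
  move=> e0; have [N hN] := h _ (exprn_gt0 2 e0); exists N => m n Nm Nn.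
  have := hN m n Nm Nn; rewrite dE /= => lt.
  have := sqr_ge0 (hnorm ((u m).1 - (u n).1)).
  have := sqr_ge0 (hnorm ((u m).2 - (u n).2)) => p1 p2.
  by split; rewrite -(@ltr_pXn2r _ 2) ?nnegrE ?hnorm_ge0 ?ltW //; lra.
have [|l1 hl1] := @hilbert_cauchy _ _ (fun n => (u n).1).
  by move=> e /h' [N hN]; exists N => m n Nm Nn; case: (hN m n Nm Nn).
have [|l2 hl2] := @hilbert_cauchy _ _ (fun n => (u n).2).
  by move=> e /h' [N hN]; exists N => m n Nm Nn; case: (hN m n Nm Nn).
exists (l1, l2) => e e0.
have : (fun n => hnorm ((u n).1 - l1) ^+ 2 + hnorm ((u n).2 - l2) ^+ 2) @ \oo
    --> (0 ^+ 2 + 0 ^+ 2 : R).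
  by apply: cvgD; [exact: (cvgM hl1 hl1)|exact: (cvgM hl2 hl2)].
move/cvgrPdist_lt => /(_ _ e0) [N _ hN]; exists N => n Nn.
rewrite dE /=; have := hN n Nn; rewrite /= expr0n /= addr0 sub0r normrN.
by apply: le_lt_trans; rewrite ler_norm.
Qed.

HB.instance Definition _ := Lmodule_isHilbert.Build R hsum hsum_complete.

End DirectSum.

Section ClosedSubspace.
Variables (R : realType) (H : hilbertType R).

Record closed_subspace := ClosedSubspace {
  cs_set :> set H;
  cs_closed : closed cs_set;
  cs_submod : submod_closed [pred x | x \in cs_set] }.

Variable M : closed_subspace.

Definition cs_pred : pred H := fun x => x \in cs_set M.

Fact cs_pred_submod : GRing.subsemimod_closed cs_pred.
Proof. exact/GRing.submod_closed_semi/(cs_submod M). Qed.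

HB.instance Definition _ := GRing.isSubmodClosed.Build R[i] H cs_pred
  cs_pred_submod.

Record csub := Csub { cs_val :> H; cs_valP : cs_pred cs_val }.

HB.instance Definition _ := [isSub for cs_val].
HB.instance Definition _ := [Choice of csub by <:].
HB.instance Definition _ := [SubChoice_isSubLmodule of csub by <:].

Definition csub_form (x y : csub) : R[i] := hdot (val x) (val y).

Fact csub_form_linear a x y z :
  csub_form (a *: x + y) z = a * csub_form x z + csub_form y z.
Proof. by rewrite /csub_form linearP /= linearDl linearZl_LR. Qed.

Fact csub_form_conj x y : csub_form x y = conjC (csub_form y x).
Proof. exact: dot_conj. Qed.

Fact csub_form_gt0 x : x != 0 -> 0 < csub_form x x.
Proof. by move=> h; rewrite dnorm_gt0. Qed.

Definition csub_dot := mk_dot csub_form_linear csub_form_conj csub_form_gt0.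

Fact csub_complete (u : nat -> csub) :
  (forall e : R, 0 < e -> exists N, forall m n, (N <= m)%N -> (N <= n)%N ->
     complex.Re (csub_dot (u m - u n) (u m - u n)) < e) ->
  exists l, forall e : R, 0 < e -> exists N, forall n, (N <= n)%N ->
     complex.Re (csub_dot (u n - l) (u n - l)) < e.
Proof.
have dE (x : csub) : complex.Re (csub_dot x x) = hnorm (val x) ^+ 2.
  by rewrite hnorm_sqr.
move=> h; have [|l hl] := @hilbert_cauchy _ _ (fun n => val (u n)).
  move=> e e0; have [N hN] := h _ (exprn_gt0 2 e0); exists N => m n Nm Nn.
  have := hN m n Nm Nn; rewrite dE raddfB.
  by rewrite ltr_pXn2r // nnegrE ?hnorm_ge0 ?ltW.
have lM : cs_pred l.
  rewrite /cs_pred in_setE; apply: (@closed_cvg _ _ \oo _ (fun n => val (u n)) (cs_set M)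
    (@cs_closed M) _ l (cvg_hnorm hl)).
  by near=> n; have := cs_valP (u n); rewrite /cs_pred in_setE.
exists (Csub lM) => e e0.
have hm : (fun n => hnorm (val (u n) - l) ^+ 2) @ \oo --> (0 * 0 : R).
  exact: (cvgM hl hl).
move/cvgrPdist_lt : hm => /(_ _ e0) [N _ hN].
exists N => n Nn; have := hN n Nn; rewrite dE raddfB /= mulr0 sub0r normrN.
by apply: le_lt_trans; rewrite ler_norm.
Unshelve. all: by end_near. Qed.

HB.instance Definition _ := Lmodule_isHilbert.Build R csub csub_complete.

End ClosedSubspace.

Section Ell2.
Variables (R : realType) (L : hilbertType R).

Definition sq_summable : pred (nat -> L) :=
  fun x => `[< cvgn (series (fun n => hnorm (x n) ^+ 2)) >].

Fact sq_summable_submod : GRing.subsemimod_closed sq_summable.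
Proof.
apply: GRing.submod_closed_semi; split.
  apply/asboolP; rewrite (_ : (fun _ => _) = fun=> 0).
    apply/cvg_ex; exists 0; rewrite /series /=.
    by under eq_fun do rewrite big1 //; exact: cvg_cst.
  by apply/funext => n; rewrite /= /GRing.zero /= hnorm0 expr0n.
move=> a x y /asboolP hx /asboolP hy; apply/asboolP.
set c := complex.Re `|a|.
pose v n : R := 2 * c ^+ 2 * hnorm (x n) ^+ 2 + 2 * hnorm (y n) ^+ 2.
apply: (@series_le_cvg _ _ v) => [n|n|n|]; first exact: sqr_ge0.
- rewrite /v; have := sqr_ge0 (c * hnorm (x n)).
  by have := sqr_ge0 (hnorm (y n)); nra.
- rewrite /v; have := ler_hnormD (a *: x n) (y n); rewrite hnormZ -/c => h.
  have h2 : hnorm (a *: x n + y n) ^+ 2 <= (c * hnorm (x n) + hnorm (y n)) ^+ 2.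
    by rewrite ler_pXn2r // nnegrE ?hnorm_ge0 // (le_trans _ h) ?hnorm_ge0.
  rewrite [X in X <= _](_ : _ = hnorm (a *: x n + y n) ^+ 2) //.
  apply: le_trans h2 _.
  by have := sqr_ge0 (c * hnorm (x n) - hnorm (y n)); nra.
- have := is_cvg_seriesD 
    (is_cvg_seriesZ (k := 2 * c ^+ 2) hx) (is_cvg_seriesZ (k := 2) hy).
  by congr (cvgn (series _)).
Qed.

HB.instance Definition _ := GRing.isSubmodClosed.Build R[i] (nat -> L) sq_summable
  sq_summable_submod.

Record ell2 := Ell2 { ell2_val :> nat -> L; ell2_valP : sq_summable ell2_val }.

HB.instance Definition _ := [isSub for ell2_val].
HB.instance Definition _ := [Choice of ell2 by <:].
HB.instance Definition _ := [SubChoice_isSubLmodule of ell2 by <:].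

(* Sum of a complex series, by its real and imaginary parts. *)
Definition csum (u : nat -> R[i]) : R[i] :=
  limn (series (fun n => complex.Re (u n)))
  +i* limn (series (fun n => complex.Im (u n))).

Let ccvg (u : nat -> R[i]) : Prop :=
  cvgn (series (fun n => complex.Re (u n))) /\
  cvgn (series (fun n => complex.Im (u n))).

Let is_cvg_lin (p q : R) (f g : nat -> R) : cvgn (series f) -> cvgn (series g) ->
  cvgn (series (fun n => p * f n + q * g n)).
Proof.
move=> hf hg.
have := is_cvg_seriesD (is_cvg_seriesZ (k := p) hf) (is_cvg_seriesZ (k := q) hg).
by congr (cvgn (series _)).
Qed.

Let lim_lin (p q : R) (f g : nat -> R) : cvgn (series f) -> cvgn (series g) ->
  limn (series (fun n => p * f n + q * g n)) =
  p * limn (series f) + q * limn (series g).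
Proof.
move=> hf hg.
have := lim_seriesD (is_cvg_seriesZ (k := p) hf) (is_cvg_seriesZ (k := q) hg).
by rewrite !lim_seriesZ.
Qed.

Let csum_lin a u v : ccvg u -> ccvg v ->
  csum (fun n => a * u n + v n) = a * csum u + csum v.
Proof.
move=> [ur ui] [vr vi].
have eR : (fun n => complex.Re (a * u n + v n)) =
    (fun n => 1 * (complex.Re a * complex.Re (u n)
                   + (- complex.Im a) * complex.Im (u n)) + 1 * complex.Re (v n)).
  by apply/funext => n; case: (a) (u n) (v n) => ? ? [? ?] [? ?] /=; ring.
have eI : (fun n => complex.Im (a * u n + v n)) =
    (fun n => 1 * (complex.Re a * complex.Im (u n)
                   + complex.Im a * complex.Re (u n)) + 1 * complex.Im (v n)).
  by apply/funext => n; case: (a) (u n) (v n) => ? ? [? ?] [? ?] /=; ring.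
have cR := @is_cvg_lin (complex.Re a) (- complex.Im a) _ _ ur ui.
have cI := @is_cvg_lin (complex.Re a) (complex.Im a) _ _ ui ur.
rewrite /csum eR eI (@lim_lin 1 1 _ _ cR vr) (@lim_lin 1 1 _ _ cI vi).
rewrite (@lim_lin _ _ _ _ ur ui) (@lim_lin _ _ _ _ ui ur).
clear eR eI cR cI; case: a => ar ai; apply/eqP; rewrite eq_complex /=; apply/andP; split;
  apply/eqP; ring.
Qed.

Let csum_conj u : ccvg u -> csum (fun n => conjC (u n)) = conjC (csum u).
Proof.
move=> [_ ui].
have eR : (fun n => complex.Re (conjC (u n))) = (fun n => complex.Re (u n)).
  by apply/funext => n; case: (u n).
have eI : (fun n => complex.Im (conjC (u n))) = - (fun n => complex.Im (u n)).
  by apply/funext => n; rewrite /GRing.opp /=; case: (u n).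
by rewrite /csum eR eI lim_seriesN.
Qed.

Let sqs (x : ell2) : cvgn (series (fun n => hnorm (x n) ^+ 2)).
Proof. by have /asboolP := ell2_valP x. Qed.

Let Re_hdot_cvg (x y : ell2) :
  cvgn (series (fun n => complex.Re (hdot (x n) (y n)))).
Proof.
apply: (@normed_cvg R R).
apply: (@series_le_cvg _ _ (fun n => 1 * hnorm (x n) ^+ 2 + 1 * hnorm (y n) ^+ 2)).
- by move=> n; exact: normr_ge0.
- by move=> n /=; rewrite !mul1r; apply: addr_ge0; exact: sqr_ge0.
- move=> n /=; rewrite !mul1r.
  have h1 := Re_hdot_le (x n) (y n).
  have h2 := Re_hdot_le (- x n) (y n).
  have h3 : complex.Re (hdot (- x n) (y n)) = - complex.Re (hdot (x n) (y n)).
    by rewrite linearNl /=; case: (hdot (x n) (y n)) => a b.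
  rewrite h3 hnormN in h2.
  have := sqr_ge0 (hnorm (x n) - hnorm (y n)).
  have := sqr_ge0 (hnorm (x n)); have := sqr_ge0 (hnorm (y n)).
  by rewrite ler_norml => ? ? ?; apply/andP; split; nra.
- exact: is_cvg_lin.
Qed.

Let hdot_cvg (x y : ell2) : ccvg (fun n => hdot (x n) (y n)).
Proof.
split; first exact: Re_hdot_cvg.
have := @Re_hdot_cvg x ('i%C *: y).
rewrite (_ : (fun n => complex.Re _) = (fun n => complex.Im (hdot (x n) (y n)))) //.
apply/funext => n; have -> : ('i%C *: y : ell2) n = 'i%C *: y n by [].
by rewrite linearZr_LR /=; case: (hdot (x n) (y n)) => a b /=; ring.
Qed.

Definition ell2_form (x y : ell2) : R[i] := csum (fun n => hdot (x n) (y n)).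

Fact ell2_form_linear a (x y z : ell2) :
  ell2_form (a *: x + y) z = a * ell2_form x z + ell2_form y z.
Proof.
rewrite /ell2_form -csum_lin; [|exact: hdot_cvg|exact: hdot_cvg].
congr csum; apply/funext => n.
have -> : (a *: x + y : ell2) n = a *: x n + y n by [].
by rewrite linearDl linearZl_LR.
Qed.

Fact ell2_form_conj x y : ell2_form x y = conjC (ell2_form y x).
Proof.
rewrite /ell2_form -csum_conj; last exact: hdot_cvg.
by congr csum; apply/funext => n; rewrite dot_conj.
Qed.

Let ell2_form_diag (x : ell2) :
  ell2_form x x = (limn (series (fun n => hnorm (x n) ^+ 2)))%:C.
Proof.
rewrite /ell2_form /csum; congr Complex.
  by congr (limn (series _)); apply/funext => n; rewrite hnorm_sqr.
rewrite (_ : (fun n => complex.Im _) = fun=> 0).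
  by apply/cvg_lim => //; rewrite /series /=; under eq_fun do rewrite big1 //; exact: cvg_cst.
by apply/funext => n; rewrite dot_diagE.
Qed.

Lemma ell2_partial_le (x : ell2) N :
  \sum_(0 <= n < N) hnorm (x n) ^+ 2 <= limn (series (fun n => hnorm (x n) ^+ 2)).
Proof.
have nd : {homo series (fun n => hnorm (x n) ^+ 2) : m n / (m <= n)%N >-> m <= n}.
  by apply: nondecreasing_series => n _ _; exact: sqr_ge0.
exact: (nondecreasing_cvgn_le nd (@sqs x) N).
Qed.

Let coord_le (x : ell2) n :
  hnorm (x n) ^+ 2 <= limn (series (fun n => hnorm (x n) ^+ 2)).
Proof.
apply: le_trans (ell2_partial_le x n.+1).
rewrite big_nat_recr //= lerDr.
by apply: sumr_ge0 => i _; exact: sqr_ge0.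
Qed.

Fact ell2_form_gt0 x : x != 0 -> 0 < ell2_form x x.
Proof.
move=> x0; rewrite ell2_form_diag ltcR.
have [n xn] : exists n, x n != 0.
  apply: contrapT => /forallNP h; move/eqP: x0; apply.
  by apply: val_inj; apply/funext => n /=; have /negP := h n; rewrite negbK => /eqP.
apply: lt_le_trans (coord_le x n).
rewrite exprn_gt0 // lt_def hnorm_ge0 andbT.
by apply: contra xn => /eqP h; rewrite -normr_eq0 normE_hnorm h.
Qed.

Definition ell2_dot := mk_dot ell2_form_linear ell2_form_conj ell2_form_gt0.

Let dE (x : ell2) :
  complex.Re (ell2_dot x x) = limn (series (fun n => hnorm (x n) ^+ 2)).
Proof. by rewrite [ell2_dot x x]ell2_form_diag. Qed.

Lemma sq_summable_bound (x : nat -> L) (e : R) :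
  (forall K, \sum_(0 <= k < K) hnorm (x k) ^+ 2 <= e) ->
  sq_summable x /\ limn (series (fun k => hnorm (x k) ^+ 2)) <= e.
Proof.
move=> hx; have cx : cvgn (series (fun k => hnorm (x k) ^+ 2)).
  apply: nondecreasing_is_cvgn.
    by apply: nondecreasing_series => n _ _; exact: sqr_ge0.
  by exists e => _ [K _ <-]; exact: hx.
split; first exact/asboolP.
by apply: limr_le => //; exact: nearW.
Qed.

Fact ell2_complete (u : nat -> ell2) :
  (forall e : R, 0 < e -> exists N, forall m n, (N <= m)%N -> (N <= n)%N ->
     complex.Re (ell2_dot (u m - u n) (u m - u n)) < e) ->
  exists l, forall e : R, 0 < e -> exists N, forall n, (N <= n)%N ->
     complex.Re (ell2_dot (u n - l) (u n - l)) < e.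
Proof.
move=> h.
have hk k : exists l : L, (fun n => hnorm (u n k - l)) @ \oo --> (0 : R).
  apply: hilbert_cauchy => e e0.
  have [N hN] := h _ (exprn_gt0 2 e0); exists N => m n Nm Nn.
  have := hN m n Nm Nn; rewrite dE => lt.
  have := le_lt_trans (@coord_le (u m - u n) k) lt.
  by rewrite ltr_pXn2r // nnegrE ?hnorm_ge0 ?ltW.
have [l hl] := choice hk.
have part (e : R) : 0 < e -> exists N, forall m, (N <= m)%N -> forall K,
    \sum_(0 <= k < K) hnorm (u m k - l k) ^+ 2 <= e.
  move=> e0; have [N hN] := h _ e0; exists N => m Nm K.
  have cv : (fun n => \sum_(0 <= k < K) hnorm (u m k - u n k) ^+ 2) @ \oo -->
      \sum_(0 <= k < K) hnorm (u m k - l k) ^+ 2.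
    elim: K => [|K IH].
      by rewrite big_geq //; under eq_fun do rewrite big_geq //; exact: cvg_cst.
    rewrite big_nat_recr //=; under eq_fun do rewrite big_nat_recr //=.
    apply: cvgD => //.
    have hc : (fun n => hnorm (u m K - u n K)) @ \oo --> hnorm (u m K - l K).
      apply/cvgrPdist_lt => d d0; move/cvgrPdist_lt : (hl K) => /(_ d d0).
      apply: filterS => n; rewrite sub0r normrN ger0_norm ?hnorm_ge0 //.
      apply: le_lt_trans; apply: le_trans (hnormB_le _ _) _.
      by rewrite opprB addrC addrA subrK.
    exact: (cvgM hc hc).
  rewrite -(cvg_lim _ cv) //; apply: limr_le; first by apply/cvg_ex; eexists; exact: cv.
  exists N => // n /= Nn; apply: ltW.
  by have := hN m n Nm Nn; rewrite dE; apply: le_lt_trans; exact: (ell2_partial_le (u m - u n)).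
have ls : sq_summable l.
  have [N hN] := part 1 ltr01.
  have d : sq_summable (fun k => u N k - l k).
    by have [] := sq_summable_bound (hN N (leqnn N)).
  have := rpredB (ell2_valP (u N)) d.
  by congr (is_true (sq_summable _)); apply/funext => k /=; rewrite /GRing.add /= /GRing.opp /= subKr.
exists (Ell2 ls) => e e0; have [N hN] := part _ (divr_gt0 e0 (ltr0n _ 2)).
exists N => n Nn; rewrite dE; have [_ le] := sq_summable_bound (hN n Nn).
apply: le_lt_trans le _; lra.
Qed.

HB.instance Definition _ := Lmodule_isHilbert.Build R ell2 ell2_complete.

Lemma ell2_hnorm (x : ell2) :
  hnorm x ^+ 2 = limn (series (fun n => hnorm (x n) ^+ 2)).
Proof. by rewrite hnorm_sqr -dE. Qed.

End Ell2.

Section Operators.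
Variables (R : realType) (H K : hilbertType R).

Definition bounded_linear : pred (H -> K) := fun f =>
  `[< linear f /\ exists M : R, forall x, hnorm (f x) <= M * hnorm x >].

Fact bounded_linear_submod : GRing.subsemimod_closed bounded_linear.
Proof.
apply: GRing.submod_closed_semi; split.
  apply/asboolP; split=> [a x y|]; first by rewrite /GRing.zero /= scaler0 addr0.
  by exists 0 => x; rewrite /GRing.zero /= hnorm0 mul0r.
move=> a f g /asboolP[fl [M fM]] /asboolP[gl [N gN]]; apply/asboolP; split.
  move=> c x y; change (a *: f (c *: x + y) + g (c *: x + y) =
    c *: (a *: f x + g x) + (a *: f y + g y)).
  rewrite fl gl !scalerDr addrACA; congr (_ + _ + _).
  by rewrite !scalerA mulrC.
exists (complex.Re `|a| * M + N) => x.
change (hnorm (a *: f x + g x) <= (complex.Re `|a| * M + N) * hnorm x).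
apply: le_trans (ler_hnormD _ _) _; rewrite hnormZ mulrDl lerD //.
rewrite -mulrA ler_wpM2l //.
by have := normr_ge0 a; rewrite lecE => /andP[].
Qed.

HB.instance Definition _ := GRing.isSubmodClosed.Build R[i] (H -> K) bounded_linear
  bounded_linear_submod.

(* Bounded linear operators, with their pointwise vector space structure. *)
Record bop := Bop { bop_fun :> H -> K; bop_funP : bounded_linear bop_fun }.

HB.instance Definition _ := [isSub for bop_fun].
HB.instance Definition _ := [Choice of bop by <:].
HB.instance Definition _ := [SubChoice_isSubLmodule of bop by <:].

Fact bop_is_linear (T : bop) : linear T.
Proof. by have /asboolP[] := bop_funP T. Qed.

HB.instance Definition _ (T : bop) :=
  GRing.isLinear.Build R[i] H K _ (T : H -> K) (bop_is_linear T).

Lemma bop_bounded (T : bop) :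
  exists2 M : R, 0 <= M & forall x, hnorm (T x) <= M * hnorm x.
Proof.
have /asboolP[_ [M hM]] := bop_funP T; exists `|M| => // x.
by apply: le_trans (hM x) _; rewrite ler_wpM2r ?hnorm_ge0 ?ler_norm.
Qed.

Fact mk_bop_subproof (f : H -> K) (M : R) :
  linear f -> (forall x, hnorm (f x) <= M * hnorm x) -> bounded_linear f.
Proof. by move=> fl fM; apply/asboolP; split=> //; exists M. Qed.

Definition mk_bop (f : H -> K) (fl : linear f) (M : R)
  (fM : forall x, hnorm (f x) <= M * hnorm x) : bop := Bop (mk_bop_subproof fl fM).

Definition opnorm (T : bop) : R := sup [set hnorm (T x) | x in [set x | hnorm x <= 1]].

Fact range_closure_submod (T : bop) :
  submod_closed [pred y | y \in closure (range T)].
Proof.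
have clE (y : K) : closure (range T) y <->
    forall e : R, 0 < e -> exists x, hnorm (y - T x) < e.
  split=> [h e e0|h B].
    have e0' : 0 < e%:C by rewrite ltcR.
    have [_ [[x _ <-]]] := h _ (nbhsx_ballx y (e%:C) e0').
    by rewrite -ball_normE /= normE_hnorm ltcR => ?; exists x.
  move=> /nbhs_ballP [[a b]]; rewrite /= ltcE /= => /andP[/eqP -> a0] sB.
  have [x xe] := h _ a0; exists (T x); split; first by exists x.
  by apply: sB; rewrite -ball_normE /= normE_hnorm ltcR.
split=> [|a x y]; first by rewrite inE; apply: subset_closure; exists 0 => //; rewrite linear0.
rewrite !inE => /clE hx /clE hy; apply/clE => e e0.
set c := complex.Re `|a|.
have c0 : 0 <= c by have := normr_ge0 a; rewrite lecE => /andP[].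
have d0 : 0 < e / (2 * (c + 1)) by rewrite divr_gt0 // mulr_gt0 // ltr_wpDl.
have [u hu] := hx _ d0; have [v hv] := hy _ (divr_gt0 e0 (ltr0n _ 2)).
exists (a *: u + v); rewrite linearP opprD addrACA -scalerBr.
apply: le_lt_trans (ler_hnormD _ _) _; rewrite hnormZ -/c [ltRHS]splitr.
apply: ler_ltD => //; apply: le_trans (ler_wpM2l c0 (ltW hu)) _.
rewrite mulrA ler_pdivrMr ?mulr_gt0 ?ltr_wpDl // -subr_ge0.
have -> : e / 2 * (2 * (c + 1)) - c * e = e by field.
exact: ltW.
Qed.

Definition range_closure (T : bop) : closed_subspace K :=
  @ClosedSubspace R K (closure (range T)) (@closed_closure _ _)
    (range_closure_submod T).

End Operators.

Section Composition.
Variables (R : realType) (H K L : hilbertType R).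

Fact bid_bound (x : H) : hnorm (@id H x) <= 1 * hnorm x.
Proof. by rewrite mul1r. Qed.

Fact id_linear : linear (@id H). Proof. by []. Qed.

Definition bid : bop H H := mk_bop id_linear bid_bound.

Fact bcomp_subproof (S : bop K L) (T : bop H K) : bounded_linear (S \o T).
Proof.
apply/asboolP; split=> [a x y|]; first by rewrite /= !linearP.
have [M M0 hM] := bop_bounded S; have [N N0 hN] := bop_bounded T.
exists (M * N) => x /=; apply: le_trans (hM _) _.
by rewrite -mulrA ler_wpM2l.
Qed.

Definition bcomp (S : bop K L) (T : bop H K) : bop H L := Bop (bcomp_subproof S T).

End Composition.

Arguments bid {R} H.
Notation "S \cmp T" := (bcomp S T) (at level 40, left associativity) : ring_scope.

Section SumOperators.
Variables (R : realType) (H K : hilbertType R).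

Lemma hsum_hnorm (x : hsum H K) : hnorm x ^+ 2 = hnorm x.1 ^+ 2 + hnorm x.2 ^+ 2.
Proof. by rewrite !hnorm_sqr /= /hsum_form; case: (hdot _ _); case: (hdot _ _). Qed.

Let sqr_le (a b : R) : 0 <= a -> 0 <= b -> a ^+ 2 <= b ^+ 2 -> a <= 1 * b.
Proof. by move=> a0 b0; rewrite ler_pXn2r ?nnegrE // mul1r. Qed.

Fact hfst_bound (x : hsum H K) : hnorm x.1 <= 1 * hnorm x.
Proof. by apply: sqr_le; rewrite ?hnorm_ge0 // hsum_hnorm lerDl sqr_ge0. Qed.

Fact hsnd_bound (x : hsum H K) : hnorm x.2 <= 1 * hnorm x.
Proof. by apply: sqr_le; rewrite ?hnorm_ge0 // hsum_hnorm lerDr sqr_ge0. Qed.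

Fact hinl_bound (x : H) : hnorm ((x, 0) : hsum H K) <= 1 * hnorm x.
Proof.
by apply: sqr_le; rewrite ?hnorm_ge0 // hsum_hnorm /= hnorm0 expr0n addr0.
Qed.

Fact hinr_bound (y : K) : hnorm ((0, y) : hsum H K) <= 1 * hnorm y.
Proof.
by apply: sqr_le; rewrite ?hnorm_ge0 // hsum_hnorm /= hnorm0 expr0n add0r.
Qed.

Fact hfst_linear : linear (fun x : hsum H K => x.1). Proof. by []. Qed.
Fact hsnd_linear : linear (fun x : hsum H K => x.2). Proof. by []. Qed.
Fact hinl_linear : linear (fun x : H => (x, 0) : hsum H K).
Proof. by move=> a x y; congr pair; rewrite /= scaler0 addr0. Qed.
Fact hinr_linear : linear (fun y : K => (0, y) : hsum H K).
Proof. by move=> a x y; congr pair; rewrite /= scaler0 addr0. Qed.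

Definition hfst : bop (hsum H K) H := mk_bop hfst_linear hfst_bound.
Definition hsnd : bop (hsum H K) K := mk_bop hsnd_linear hsnd_bound.
Definition hinl : bop H (hsum H K) := mk_bop hinl_linear hinl_bound.
Definition hinr : bop K (hsum H K) := mk_bop hinr_linear hinr_bound.

(* The operator with matrix [A B; C D] on the direct sum. *)
Definition block_bop (A : bop H H) (B : bop K H) (C : bop H K) (D : bop K K) :
    bop (hsum H K) (hsum H K) :=
  hinl \cmp (A \cmp hfst + B \cmp hsnd) + hinr \cmp (C \cmp hfst + D \cmp hsnd).

End SumOperators.

Section Inclusion.
Variables (R : realType) (H : hilbertType R) (M : closed_subspace H).

Fact csub_incl_linear : linear (fun x : csub M => val x).
Proof. by move=> a x y; rewrite linearP. Qed.

Fact csub_incl_bound (x : csub M) : hnorm (val x) <= 1 * hnorm x.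
Proof. by rewrite mul1r -(@ler_pXn2r _ 2) ?nnegrE ?hnorm_ge0 // !hnorm_sqr. Qed.

Definition csub_incl : bop (csub M) H := mk_bop csub_incl_linear csub_incl_bound.

End Inclusion.

Section Ell2Operators.
Variables (R : realType).

Section MkEll2.
Variables (H L : hilbertType R) (f : H -> nat -> L).
Hypothesis fl : forall n, linear (f^~ n).
Hypothesis fM : exists2 M : R, 0 <= M & forall x N,
  \sum_(0 <= k < N) hnorm (f x k) ^+ 2 <= (M * hnorm x) ^+ 2.

Fact mk_ell2_summable x : sq_summable (f x).
Proof. by have [M _ hM] := fM; exact: (sq_summable_bound (hM x)).1. Qed.

Let g x : ell2 L := Ell2 (mk_ell2_summable x).

Fact mk_ell2_subproof : bounded_linear g.
Proof.
apply/asboolP; split=> [a x y|].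
  by apply: val_inj; apply/funext => n; exact: fl.
have [M M0 hM] := fM; exists M => x.
rewrite -(@ler_pXn2r _ 2) ?nnegrE ?mulr_ge0 ?hnorm_ge0 // ell2_hnorm.
exact: (sq_summable_bound (hM x)).2.
Qed.

Definition mk_ell2_bop : bop H (ell2 L) := Bop mk_ell2_subproof.

End MkEll2.

Variables (L L' : hilbertType R).

Let shift_fun (x : ell2 L) (n : nat) : L := if n is m.+1 then x m else 0.

Fact shift_linear n : linear (shift_fun^~ n).
Proof. by move=> a x y; case: n => [|n] //=; rewrite scaler0 addr0. Qed.

Fact shift_bound : exists2 M : R, 0 <= M & forall x N,
  \sum_(0 <= k < N) hnorm (shift_fun x k) ^+ 2 <= (M * hnorm x) ^+ 2.
Proof.
exists 1 => // x N.
rewrite mul1r; case: N => [|N]; first by rewrite big_geq // sqr_ge0.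
rewrite big_nat_recl //= hnorm0 expr0n add0r ell2_hnorm.
exact: ell2_partial_le.
Qed.

Definition fshift : bop (ell2 L) (ell2 L) := mk_ell2_bop shift_linear shift_bound.

Let inj0_fun (x : L) (n : nat) : L := if n is 0%N then x else 0.

Fact inj0_linear n : linear (inj0_fun^~ n).
Proof. by move=> a x y; case: n => [|n] //=; rewrite scaler0 addr0. Qed.

Fact inj0_bound : exists2 M : R, 0 <= M & forall x N,
  \sum_(0 <= k < N) hnorm (inj0_fun x k) ^+ 2 <= (M * hnorm x) ^+ 2.
Proof.
exists 1 => // x N.
rewrite mul1r; case: N => [|N]; first by rewrite big_geq // sqr_ge0.
by rewrite big_nat_recl //= big1 ?addr0 // => i _; rewrite hnorm0 expr0n.
Qed.

Definition inj0 : bop L (ell2 L) := mk_ell2_bop inj0_linear inj0_bound.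

Fact ell2_map_bound (A : bop L L') :
  exists2 M : R, 0 <= M & forall (x : ell2 L) N,
    \sum_(0 <= k < N) hnorm (A (x k)) ^+ 2 <= (M * hnorm x) ^+ 2.
Proof.
have [M M0 hM] := bop_bounded A; exists M => // x N.
have h : \sum_(0 <= k < N) hnorm (A (x k)) ^+ 2 <=
         \sum_(0 <= k < N) M ^+ 2 * hnorm (x k) ^+ 2.
  apply: ler_sum => k _; rewrite -exprMn.
  by rewrite ler_pXn2r ?nnegrE ?mulr_ge0 ?hnorm_ge0.
apply: le_trans h _; rewrite -big_distrr /= exprMn ler_wpM2l ?sqr_ge0 //.
by rewrite ell2_hnorm; exact: ell2_partial_le.
Qed.

Fact ell2_map_linear (A : bop L L') n : linear (fun x : ell2 L => A (x n)).
Proof. by move=> a x y; rewrite -linearP. Qed.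

Definition ell2_map (A : bop L L') : bop (ell2 L) (ell2 L') :=
  mk_ell2_bop (ell2_map_linear A) (ell2_map_bound A).

End Ell2Operators.

Section OperatorTheory.
Variable R : realType.
Implicit Types H K : hilbertType R.

(* The operator characterized by <T x, y> = <x, T^* y>: it is unique, and it
   exists by the Riesz representation theorem. *)
Definition adj H K (T : bop H K) : bop K H :=
  xget 0 [set T' : bop K H | forall x y, hdot (T x) y = hdot x (T' y)].

Definition positive_op H (A : bop H H) : Prop := forall x, 0 <= hdot (A x) x.

Definition op_le H (A B : bop H H) : Prop := positive_op (B - A).

(* The unique positive square root of a positive operator. *)
Definition op_sqrt H (A : bop H H) : bop H H :=
  xget 0 [set B : bop H H | positive_op B /\ B \cmp B = A].

Definition isometric H K (V : bop H K) : Prop := adj V \cmp V = bid H.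

Definition unitary H K (U : bop H K) : Prop := isometric U /\ U \cmp adj U = bid K.

Definition Delta H (T : bop H H) : bop H H := adj T \cmp T - bid H.

Definition similar_to_isometry H (T : bop H H) : Prop :=
  exists (K : hilbertType R) (V : bop K K) (X : bop H K) (Y : bop K H),
    [/\ isometric V, Y \cmp X = bid H, X \cmp Y = bid K & T = Y \cmp V \cmp X].

Definition quasi_isometry H (T : bop H H) : Prop :=
  adj T \cmp (adj T \cmp T) \cmp T = adj T \cmp T.

Definition two_isometry H (S : bop H H) : Prop :=
  adj S \cmp adj S \cmp S \cmp S - (adj S \cmp S) *+ 2 + bid H = 0.

Definition cov H (S : bop H H) : R := Num.sqrt (opnorm (Delta S)).

Definition closed_span H (A : set H) : set H :=
  \bigcap_(M in [set M : closed_subspace H | A `<=` M]) M.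

(* Below, H is identified with a closed subspace of K through an isometry
   V : H -> K; the orthogonal projection P_H of K onto H is then V^*. *)

Definition lifting H K (V : bop H K) (T : bop H H) (S : bop K K) : Prop :=
  isometric V /\ adj V \cmp S = T \cmp adj V.

Definition minimal H K (V : bop H K) (S : bop K K) : Prop :=
  closed_span [set iter n S (V h) | n in setT & h in setT] = setT.

Definition type_I H K (V : bop H K) (S : bop K K) : Prop :=
  forall x : K, (forall h : H, hdot x (V h) = 0) -> Delta S x = 0.

Definition minimal_2isometric_lifting_type_I H K (V : bop H K) (T : bop H H)
    (S : bop K K) : Prop :=
  [/\ lifting V T S, two_isometry S, minimal V S & type_I V S].

Definition A_sub H (A T : bop H H) : bop H H := A - Delta T.

Definition defect_space H (A T : bop H H) : hilbertType R :=
  csub (range_closure (A_sub A T)).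

(* The range of A_T^{1/2} is contained in the closure of the range of A_T;
   composing with the orthogonal projection, the adjoint of the inclusion,
   turns A_T^{1/2} into an operator with that codomain. *)
Definition A_sub_sqrt H (A T : bop H H) : bop H (defect_space A T) :=
  adj (csub_incl (range_closure (A_sub A T))) \cmp op_sqrt (A_sub A T).

Definition S_op H (A T : bop H H) :
    bop (hsum (ell2 (defect_space A T)) H) (hsum (ell2 (defect_space A T)) H) :=
  block_bop (fshift _) (inj0 _ \cmp A_sub_sqrt A T) 0 T.

(* For a closed subspace M of H, the map
   ((x_0, x_1, ...), h) |-> (h, x_0, x_1, ...) from l^2(M) (+) H to l^2(H);
   it is unitary exactly when M is the whole of H. *)
Definition ell2_ident H (M : closed_subspace H) :
    bop (hsum (ell2 (csub M)) H) (ell2 H) :=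
  fshift H \cmp ell2_map (csub_incl M) \cmp hfst _ _ + inj0 H \cmp hsnd _ _.

(* S_{A,T} is well defined, its space is identified with l^2(H), and it is a
   minimal 2-isometric lifting of T of type I, both on l^2(closure of ran A_T) (+) H and
   after transport to l^2(H). *)
Definition S_op_lifts H (A T : bop H H) : Prop :=
  let U := ell2_ident (range_closure (A_sub A T)) in
  [/\ [/\ positive_op A, adj T \cmp A \cmp T = A & op_le (Delta T) A],
      unitary U,
      minimal_2isometric_lifting_type_I (hinr _ H) T (S_op A T) &
      minimal_2isometric_lifting_type_I (U \cmp hinr _ H) T
        (U \cmp S_op A T \cmp adj U)].

End OperatorTheory.

(* Main.v *)
Require Import Defs.
From mathcomp Require Import all_boot all_order all_algebra.
From mathcomp Require Import all_classical all_reals all_analysis.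
From mathcomp Require Import complex.
From mathcomp Require Import ring lra.
Import Order.TTheory GRing.Theory Num.Theory.
Import numFieldNormedType.Exports.
Local Open Scope classical_set_scope.
Local Open Scope ring_scope.
Local Open Scope complex_scope.
Set Implicit Arguments.
Unset Strict Implicit.
Unset Printing Implicit Defensive.

(** Everything rests on one inequality.  Let A >= 0 with T^* A T = A, and let
    A_T = A - T^* T + I.  If A_T >= I, then A_T is invertible, so the closure
    of its range is all of H and the space l^2(closure of ran A_T) (+) H is
    identified with l^2(H) by putting the H-component in front.  In both cases of
    the theorem A_T >= I holds: for A >= I because A - T^* T = T^* (A - I) T,
    and for A = T^* T because A_T = I.

    Under this inequality the properties of S = S_{A,T} come from computing
    |S(x,h)|^2.  The summands S_+ x and J A_T^{1/2} h are orthogonal, hence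

      |S(x,h)|^2 = |x|^2 + <A_T h, h> + |T h|^2 = |(x,h)|^2 + <A h, h>,

    that is, Delta_S = 0 (+) A ([Delta_S_op]).  So Delta_S vanishes on
    l^2 (+) 0 (type I), its norm is that of A (covariance), and
    S^* Delta_S S = 0 (+) T^* A T = Delta_S, which is the 2-isometry identity.
    Minimality holds because S(0,h) - (0,Th) = (J A_T^{1/2} h, 0) and S acts on
    l^2 (+) 0 as the shift: a vector orthogonal to all S^n (0,h) has all its
    coordinates orthogonal to the range of A_T^{1/2} ([S_op_total]).

    When T = X^{-1} V X with V isometric, A = X^* X satisfies T^* A T = A, and it
    is bounded below because X is.

    Three facts of Hilbert space theory carry this.  [lax_milgram] minimises
    <A x, x> - 2 Re f(x) for a symmetric A >= I; with A = I it is the Riesz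
    theorem, which gives adjoints ([hdot_adj]), and with A = A_T it gives the
    surjectivity of A_T.  [coercive_sqrt] gives a positive square root of an
    operator A >= I: it is sqrt c (I - Y), where Y is the fixed point of
    Y |-> (I - A/c + Y^2)/2, a contraction because I - A/c has norm less than 1
    for large c.
    [numerical_range0], the complex polarisation argument, reduces identities
    between operators to identities between quadratic forms. *)

(** * Inner products *)

Section InnerProduct.
Variables (R : realType) (H K : hilbertType R).

Lemma bop_ext (A B : bop H K) : (forall x, A x = B x) -> A = B.
Proof. by move=> h; apply: val_inj; apply/funext. Qed.

Lemma hdotDl (x y z : H) : hdot (x + y) z = hdot x z + hdot y z.
Proof. exact: linearDl. Qed.

Lemma hdotDr (x y z : H) : hdot x (y + z) = hdot x y + hdot x z.
Proof. exact: linearDr. Qed.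

Lemma hdotBl (x y z : H) : hdot (x - y) z = hdot x z - hdot y z.
Proof. exact: linearBl. Qed.

Lemma hdotBr (x y z : H) : hdot x (y - z) = hdot x y - hdot x z.
Proof. exact: linearBr. Qed.

Lemma hdotZl (a : R[i]) (x y : H) : hdot (a *: x) y = a * hdot x y.
Proof. exact: linearZl_LR. Qed.

Lemma hdotZr (a : R[i]) (x y : H) : hdot x (a *: y) = a^* * hdot x y.
Proof. exact: linearZr_LR. Qed.

Lemma hdotZr_real (a : R) (x y : H) : hdot x (a%:C *: y) = a%:C * hdot x y.
Proof.
by rewrite hdotZr; congr (_ * _); apply/eqP; rewrite eq_complex /= oppr0 !eqxx.
Qed.

Lemma hdot0l (x : H) : hdot 0 x = 0.
Proof. exact: linear0l. Qed.

Lemma hdot0r (x : H) : hdot x 0 = 0.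
Proof. exact: linear0r. Qed.

Lemma hdotC (x y : H) : hdot x y = (hdot y x)^*.
Proof. exact: dot_conj. Qed.

Lemma Re_hdotC (x y : H) : complex.Re (hdot x y) = complex.Re (hdot y x).
Proof. exact: dot_ReC. Qed.

Lemma hdot_ext (x z : H) : (forall y : H, hdot x y = hdot z y) -> x = z.
Proof.
move=> h; apply/subr0_eq/(@dot_diag_eq0 _ _ (@hdot R H)).
by rewrite hdotBl h subrr.
Qed.

Lemma hdot_extr (x z : H) : (forall y : H, hdot y x = hdot y z) -> x = z.
Proof. by move=> h; apply: hdot_ext => y; rewrite hdotC h -hdotC. Qed.

Lemma hdot_diagE (x : H) : hdot x x = (hnorm x ^+ 2)%:C.
Proof. by rewrite dot_diagE hnorm_sqr. Qed.

Lemma hnorm_eq0 (x : H) : hnorm x = 0 -> x = 0.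
Proof.
move=> h; apply: (@dot_diag_eq0 _ _ (@hdot R H)).
by rewrite -hnorm_sqr h expr0n.
Qed.

(** A complex linear functional is determined by its real part, as
    Im f(x) = - Re f(i x). *)
Lemma Re_linear_ext (f g : H -> R[i]) :
  (forall x, f ('i *: x) = 'i * f x) -> (forall x, g ('i *: x) = 'i * g x) ->
  (forall x, complex.Re (f x) = complex.Re (g x)) -> f =1 g.
Proof.
move=> fi gi h x; have := h ('i *: x); rewrite fi gi; have := h x.
case: (f x) (g x) => a b [c d] /= ->; rewrite !mul0r !mul1r !sub0r.
by move/oppr_inj => ->.
Qed.

End InnerProduct.

(** * The variational principle behind the Riesz theorem *)

Section Variational.
Variables (R : realType) (H : hilbertType R).

Definition symmetric_op (A : bop H H) :=
  forall x y, hdot (A x) y = hdot x (A y).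

(** The real functional phi(x) = <A x, x> - 2 Re f(x) is bounded below.  The
    parallelogram identity for the form of A makes every minimising sequence
    Cauchy, and the Euler equation of phi at the limit is the claim. *)
Lemma lax_milgram (A : bop H H) (f : H -> R[i]) (M : R) :
  symmetric_op A ->
  (forall x, hnorm x ^+ 2 <= complex.Re (hdot (A x) x)) ->
  (forall a x y, f (a *: x + y) = a * f x + f y) ->
  (forall x, complex.Re (f x) <= M * hnorm x) ->
  exists z, forall x, f x = hdot x (A z).
Proof.
move=> symA coA fl fM.
pose phi x := complex.Re (hdot (A x) x) - 2 * complex.Re (f x).
(* Half the derivative of phi at a in the direction x. *)
pose c a x := complex.Re (hdot x (A a)) - complex.Re (f x).
have phiE a x (t : R) : phi (a + t%:C *: x) =
    phi a + 2 * t * c a x + t ^+ 2 * complex.Re (hdot (A x) x).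
  have AE : A (t%:C *: x + a) = t%:C *: A x + A a by rewrite linearP.
  rewrite /phi /c [a + _]addrC fl AE !hdotDl !hdotZl.
  rewrite !hdotDr !hdotZr /=.
  rewrite -symA [hdot (A x) a]symA (hdotC x (A a)).
  case: (hdot (A a) x) => ? ?; case: (hdot (A x) x) => ? ?.
  by case: (hdot (A a) a) => ? ?; case: (f a) => ? ?; case: (f x) => ? ? /=; ring.
have phi_lb : has_inf (range phi).
  split; first by exists (phi 0); exists 0.
  exists (- M ^+ 2) => _ [x _ <-]; rewrite /phi.
  have := coA x; have := fM x; have := sqr_ge0 (hnorm x - M); nra.
set d := inf (range phi).
have dle x : d <= phi x by apply: ge_inf; [case: phi_lb|exists x].
have /choice[z hz] : forall n, exists x, phi x < d + n.+1%:R^-1.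
  move=> n; have e0 : (0 : R) < n.+1%:R^-1 by rewrite invr_gt0 ltr0n.
  by have [_ [x _ <-] lt] := inf_adherent e0 phi_lb; exists x.
have small (e : R) : 0 < e -> exists N, forall n, (N <= n)%N -> phi (z n) < d + e.
  move=> e0; exists (Num.truncn e^-1) => n Nn.
  apply: lt_trans (hz n) _; rewrite ltrD2l -[ltRHS]invrK.
  rewrite ltf_pV2 ?posrE ?invr_gt0 ?ltr0n //.
  by rewrite (lt_le_trans (truncnS_gt _)) ?ler_nat //; exact: num_real.
have [|l hl] := @hilbert_cauchy _ _ z.
  move=> e e0; have e4 : 0 < e ^+ 2 / 4 by rewrite divr_gt0 ?exprn_gt0.
  have [N hN] := small _ e4; exists N => m n Nm Nn.
  rewrite -(@ltr_pXn2r _ 2) ?nnegrE ?hnorm_ge0 ?ltW //.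
  apply: le_lt_trans (coA _) _; set w := z m - z n.
  have := hN m Nm; have := hN n Nn.
  have := dle (z n + (2^-1)%:C *: w).
  have -> : z m = z n + 1%:C *: w by rewrite scale1r addrC subrK.
  rewrite !phiE; lra.
exists l; apply: Re_linear_ext => [x|x|x].
- have f0 : f 0 = 0.
    by apply: (@addIr _ (f 0)); rewrite add0r -{1}[f 0]mul1r -fl scale1r addr0.
  by rewrite -['i *: x]addr0 fl f0 addr0.
- by rewrite hdotZl.
apply/esym/subr0_eq; rewrite -/(c l x).
set N := complex.Re (hdot (A x) x).
have N0 : 0 <= N by apply: le_trans (coA x); exact: sqr_ge0.
have key t : 0 <= 2 * t * c l x + t ^+ 2 * N.
  apply/ler_addgt0Pr => e e0.
  (* Bounds, up to the factor |z n - l|, the error made by replacing z n by l;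
     the summand 1 keeps it positive. *)
  pose k := 2 * `|t| * hnorm (A x) + 1.
  have k0 : 0 < k by rewrite ltr_wpDl // !mulr_ge0 ?hnorm_ge0.
  have [N1 h1] := small _ (divr_gt0 e0 (ltr0n _ 2)).
  have ek : 0 < e / (2 * k) by rewrite divr_gt0 ?mulr_gt0.
  move/cvgrPdist_lt : hl => /(_ _ ek) [N2 _ h2].
  set n := maxn N1 N2.
  have {}h1 := h1 n (leq_maxl _ _); have := h2 n (leq_maxr _ _).
  rewrite /= sub0r normrN ger0_norm ?hnorm_ge0 // ltr_pdivlMr ?mulr_gt0 // => h3.
  have := dle (z n + t%:C *: x); rewrite phiE -/N => h4.
  have cE : c (z n) x = c l x + complex.Re (hdot (z n - l) (A x)).
    rewrite /c -!(symA x) hdotBl raddfB /=.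
    by rewrite !(Re_hdotC (A x)); ring.
  have h5 : t * complex.Re (hdot (z n - l) (A x)) <= `|t| * hnorm (A x) * hnorm (z n - l).
    have := Re_hdot_le (t%:C *: (z n - l)) (A x).
    rewrite dot_ReZ hnormZ normc_def /= expr0n addr0 sqrtr_sqr.
    by rewrite -mulrA [hnorm (A x) * _]mulrC mulrA.
  move: h4; rewrite cE /k in h3 *; have := hnorm_ge0 (z n - l); nra.
have N1 : N + 1 != 0 by rewrite gt_eqF // ltr_wpDl.
(* A point where the quadratic in t would be negative unless c l x = 0;
   the denominator is N + 1 because N may vanish. *)
have := key (- c l x / (N + 1)).
have -> : 2 * (- c l x / (N + 1)) * c l x + (- c l x / (N + 1)) ^+ 2 * N =
   - (c l x ^+ 2 * (N + 2) / (N + 1) ^+ 2) by field.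
rewrite oppr_ge0 pmulr_lle0 ?invr_gt0 ?exprn_gt0 ?ltr_wpDl //.
rewrite pmulr_lle0 ?ltr_wpDl // => c0.
by apply/eqP; rewrite -sqrf_eq0 eq_le c0 sqr_ge0.
Qed.

End Variational.

(** * Adjoints and quadratic forms *)

Section Adjoint.
Variables (R : realType).
Implicit Types H K L : hilbertType R.

(** The Riesz theorem, that is [lax_milgram] for the identity, provides a
    candidate T^* y for each y; uniqueness makes it linear in y.  As [adj] is
    a choice among the solutions, this lemma is what gives it a meaning. *)
Lemma hdot_adj H K (T : bop H K) x y : hdot (T x) y = hdot x (adj T y).
Proof.
suff [T' hT'] : exists T' : bop K H, forall x y, hdot (T x) y = hdot x (T' y).
  have := @xgetPex _ 0 [set T' : bop K H | forall x y, hdot (T x) y = hdot x (T' y)].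
  by apply; exists T'.
have [M M0 hM] := bop_bounded T.
have /choice[g hg] : forall y, exists z, forall x, hdot (T x) y = hdot x z.
  move=> {}y; apply: (@lax_milgram _ _ (bid H) _ (M * hnorm y)) => [//|u|a u v|u].
  - by rewrite hnorm_sqr.
  - by rewrite linearP hdotDl hdotZl.
  - apply: le_trans (Re_hdot_le _ _) _; rewrite mulrAC.
    by rewrite ler_wpM2r ?hnorm_ge0.
have gl : linear g.
  move=> a u v; apply: hdot_extr => w; rewrite hdotDr hdotZr /=.
  by rewrite -!hg hdotDr hdotZr.
have gM y' : hnorm (g y') <= M * hnorm y'.
  have [g0|gN0] := eqVneq (hnorm (g y')) 0; first by rewrite g0 mulr_ge0 ?hnorm_ge0.
  have gt0 : 0 < hnorm (g y') by rewrite lt_def gN0 hnorm_ge0.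
  rewrite -(ler_pM2l gt0) -expr2 hnorm_sqr -hg.
  apply: le_trans (Re_hdot_le _ _) _; rewrite mulrA [_ * M]mulrC.
  by rewrite ler_wpM2r ?hnorm_ge0.
by exists (mk_bop gl gM).
Qed.

Lemma hdot_adjr H K (T : bop H K) x y : hdot x (T y) = hdot (adj T x) y.
Proof. by rewrite [LHS]hdotC (hdot_adj T) [RHS]hdotC. Qed.

Lemma adj_unique H K (T : bop H K) (T' : bop K H) :
  (forall x y, hdot (T x) y = hdot x (T' y)) -> adj T = T'.
Proof.
by move=> h; apply: bop_ext => y; apply: hdot_extr => x; rewrite -h hdot_adj.
Qed.

Lemma adjK H K (T : bop H K) : adj (adj T) = T.
Proof. by apply: adj_unique => x y; rewrite -hdot_adjr. Qed.

Lemma adj_cmp H K L (S : bop K L) (T : bop H K) :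
  adj (S \cmp T) = adj T \cmp adj S.
Proof. by apply: adj_unique => x y; rewrite /= !hdot_adj. Qed.

(** Polarisation: expanding the form at x + y and at i x + y gives
    <Cx,y> + <Cy,x> = 0 and <Cx,y> - <Cy,x> = 0.  This needs complex scalars,
    and is how quadratic identities become operator identities below. *)
Lemma numerical_range0 H (C : bop H H) :
  (forall x, hdot (C x) x = 0) -> C = 0.
Proof.
move=> h; apply: bop_ext => x; apply: hdot_ext => y; rewrite hdot0l.
have h1 := h (x + y).
have h2 := h ('i *: x + y).
have CD u v : C (u + v) = C u + C v by rewrite linearD.
have CZ : C ('i *: x) = 'i *: C x by rewrite linearZ.
rewrite CD hdotDl /= !hdotDr !h in h1.
rewrite CD CZ hdotDl /= !hdotDr !hdotZl in h2.
rewrite !hdotZr /= !h !mulr0 !addr0 !add0r in h1 h2.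
move: h1 h2; case: (hdot (C x) y) => a b; case: (hdot (C y) x) => c d.
move=> /eqP; rewrite eq_complex /= => /andP[/eqP h1 /eqP h2].
move=> /eqP; rewrite eq_complex /= => /andP[/eqP h3 /eqP h4].
by apply/eqP; rewrite eq_complex /=; apply/andP; split; apply/eqP; lra.
Qed.

(** The form of A - A^* is 2i times the imaginary part of the form of A,
    and a positive form is real. *)
Lemma positive_symmetric H (A : bop H H) : positive_op A -> symmetric_op A.
Proof.
move=> pA x y; rewrite [RHS]hdot_adjr.
suff /subr0_eq <- : A - adj A = 0 by [].
apply: numerical_range0 => z.
have -> : hdot ((A - adj A) z) z = hdot (A z) z - hdot (adj A z) z by rewrite -hdotBl.
rewrite -hdot_adjr [X in _ - X]hdotC.
have := pA z; rewrite lecE => /andP[/eqP i0 _].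
by case: (hdot _ _) i0 => a b /= ->; rewrite oppr0 subrr.
Qed.

Lemma isometricP H K (V : bop H K) :
  isometric V <-> forall x, hnorm (V x) = hnorm x.
Proof.
have e x : hdot ((adj V \cmp V) x) x = (hnorm (V x) ^+ 2)%:C.
  by rewrite -hdot_adjr hdot_diagE.
split=> [h x|h].
  have := e x; rewrite h hdot_diagE => /(congr1 (@complex.Re R)) /= /eqP.
  by rewrite eqrXn2 ?hnorm_ge0 // => /eqP.
apply/subr0_eq/numerical_range0 => x.
have -> : hdot ((adj V \cmp V - bid H) x) x = hdot ((adj V \cmp V) x) x - hdot x x.
  by rewrite -hdotBl.
by rewrite e h -hdot_diagE subrr.
Qed.

End Adjoint.

(** * Limits with a geometric rate *)

Section GeometricLimits.
Variables (R : realType) (H : hilbertType R).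

Lemma hnorm_distC (x y : H) : hnorm (x - y) = hnorm (y - x).
Proof. by rewrite -[LHS]Defs.hnormN opprB. Qed.

(** The iteration for the square root converges geometrically, so that passing
    to the limit in an inequality only means letting an error term K r^n
    vanish. *)
Lemma le_geometric (a b K r : R) : 0 <= r -> r < 1 ->
  (forall n, a <= b + K * r ^+ n) -> a <= b.
Proof.
move=> r0 r1 h; apply/ler_addgt0Pr => e e0.
have K0 : 0 < `|K| + 1 by rewrite ltr_wpDl.
have := cvg_expr (_ : `|r| < 1); rewrite ger0_norm // => /(_ r1).
move/cvgrPdist_lt => /(_ _ (divr_gt0 e0 K0)) [N _ /(_ N (leqnn N))].
rewrite /= sub0r normrN normrX ger0_norm // ltr_pdivlMr // => hN.
apply: le_trans (h N) _; rewrite lerD2l.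
have := exprn_ge0 N r0; have := ler_norm K; nra.
Qed.

Lemma geometric_cvg (u : nat -> H) (C r : R) : 0 <= C -> 0 <= r -> r < 1 ->
  (forall n, hnorm (u n.+1 - u n) <= C * r ^+ n) ->
  exists l, forall n, hnorm (u n - l) <= C / (1 - r) * r ^+ n.
Proof.
move=> C0 r0 r1 h; set D := C / (1 - r).
have d0 : 0 < 1 - r by rewrite subr_gt0.
have D0 : 0 <= D by rewrite divr_ge0 // ltW.
have CE : C = D * (1 - r) by rewrite /D mulfVK // gt_eqF.
have hD n k : hnorm (u (n + k)%N - u n) <= D * r ^+ n * (1 - r ^+ k).
  elim: k => [|k IH]; first by rewrite addn0 subrr hnorm0 expr0 subrr mulr0.
  have -> : u (n + k.+1)%N - u n = (u (n + k).+1 - u (n + k)%N) + (u (n + k)%N - u n).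
    by rewrite addnS addrA subrK.
  apply: le_trans (ler_hnormD _ _) _; have := h (n + k)%N.
  rewrite CE exprD exprS; lra.
have hn n m : (n <= m)%N -> hnorm (u m - u n) <= D * r ^+ n.
  move=> /subnKC <-; apply: le_trans (hD _ _) _.
  have := exprn_ge0 (m - n) r0; have := mulr_ge0 D0 (exprn_ge0 n r0); nra.
have [|l hl] := @hilbert_cauchy _ _ u.
  move=> e e0; have ND : ~ (forall n, e <= 0 + 2 * D * r ^+ n).
    by move=> /(le_geometric r0 r1); rewrite leNgt e0.
  have /existsNP[N /negP] := ND; rewrite -ltNge add0r => hN.
  exists N => m n Nm Nn; apply: le_lt_trans hN.
  have -> : u m - u n = (u m - u N) + (u N - u n) by rewrite addrA subrK.
  apply: le_trans (ler_hnormD _ _) _; rewrite (hnorm_distC (u N)).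
  have := hn _ _ Nm; have := hn _ _ Nn; lra.
exists l => n; apply/ler_addgt0Pr => e e0.
move/cvgrPdist_lt : hl => /(_ _ e0) [N _ h2].
have := h2 (maxn N n) (leq_maxl _ _).
rewrite /= sub0r normrN ger0_norm ?hnorm_ge0 // => h3.
have -> : u n - l = (u n - u (maxn N n)) + (u (maxn N n) - l) by rewrite addrA subrK.
apply: le_trans (ler_hnormD _ _) _; rewrite hnorm_distC.
by apply: lerD; [exact/hn/leq_maxr|exact: ltW].
Qed.

Lemma hnorm_geometric0 (x : H) (K r : R) : 0 <= r -> r < 1 ->
  (forall n, hnorm x <= K * r ^+ n) -> x = 0.
Proof.
move=> r0 r1 h; apply: hnorm_eq0; apply/eqP; rewrite eq_le hnorm_ge0 andbT.
by apply: (le_geometric r0 r1) => n; rewrite add0r.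
Qed.

End GeometricLimits.

(** * Square roots of operators bounded below *)

Section SquareRoot.
Variables (R : realType) (H : hilbertType R).
Implicit Types A B Y : bop H H.

Lemma symmetric_positive A : symmetric_op A ->
  (forall x, 0 <= complex.Re (hdot (A x) x)) -> positive_op A.
Proof.
move=> sA pA x; have := pA x; have := hdotC (A x) x; rewrite -sA lecE.
case: (hdot (A x) x) => a b /= [] bE ->; rewrite andbT.
by apply/eqP; lra.
Qed.

(** For a positive form bounded by r, evaluating it at x - r^-1 A x gives
    0 <= r |x|^2 - r^-1 |A x|^2. *)
Lemma symmetric_norm_le A (r : R) : symmetric_op A -> 0 < r ->
  (forall x, 0 <= complex.Re (hdot (A x) x) <= r * hnorm x ^+ 2) ->
  forall x, hnorm (A x) <= r * hnorm x.
Proof.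
move=> sA r0 hA x.
have /andP[p1 _] := hA (x - (r^-1)%:C *: A x).
have /andP[_ p2] := hA x; have /andP[_ p3] := hA (A x).
have AE : A (x - (r^-1)%:C *: A x) = A x - (r^-1)%:C *: A (A x).
  by rewrite linearB linearZ.
have E : complex.Re (hdot (A (x - (r^-1)%:C *: A x)) (x - (r^-1)%:C *: A x)) =
   complex.Re (hdot (A x) x) - 2 * r^-1 * hnorm (A x) ^+ 2
   + r^-1 ^+ 2 * complex.Re (hdot (A (A x)) (A x)).
  rewrite AE -(scaleNr _ (A x)) -(scaleNr _ (A (A x))) hdotDl !hdotDr !hdotZl !hdotZr.
  rewrite (sA (A x) x) hdot_diagE.
  case: (hdot (A x) x) => ? ?; case: (hdot (A (A x)) (A x)) => ? ? /=; ring.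
rewrite E in p1; rewrite -(@ler_pXn2r _ 2) ?nnegrE ?mulr_ge0 ?hnorm_ge0 ?(ltW r0) //.
have rr : r * r^-1 = 1 by rewrite divff // gt_eqF.
have r1 : 0 < r^-1 by rewrite invr_gt0.
have p3' : r^-1 ^+ 2 * complex.Re (hdot (A (A x)) (A x)) <= r^-1 * hnorm (A x) ^+ 2.
  have -> : r^-1 * hnorm (A x) ^+ 2 = r^-1 ^+ 2 * (r * hnorm (A x) ^+ 2).
    by rewrite expr2 -!mulrA (mulrA r^-1 r) [r^-1 * r]mulrC rr mul1r.
  by rewrite ler_wpM2l // sqr_ge0.
have p4 : r^-1 * hnorm (A x) ^+ 2 <= r * hnorm x ^+ 2 by lra.
have := ler_wpM2l (ltW r0) p4; rewrite mulrA rr mul1r exprMn; lra.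
Qed.

(** The map Y |-> (B + Y^2)/2 preserves the ball of radius r, and contracts it
    with ratio r because Y^2 - Z^2 = Y (Y - Z) + (Y - Z) Z.  The iteration is
    carried out pointwise, so completeness of H suffices. *)
Lemma half_fixpoint B (r : R) : symmetric_op B -> 0 < r -> r < 1 ->
  (forall x, hnorm (B x) <= r * hnorm x) ->
  exists Y, [/\ symmetric_op Y, forall x, hnorm (Y x) <= r * hnorm x
    & forall x, Y x + Y x = B x + Y (Y x)].
Proof.
move=> sB r0 r1 hB; have r0' := ltW r0.
pose h : R := 2^-1.
pose u n := iter n (fun Y => h%:C *: (B + Y \cmp Y)) (0 : bop H H).
have u0 x : u 0%N x = 0 by [].
have uS n x : u n.+1 x = h%:C *: (B x + u n (u n x)) by [].
have hh (x : H) : hnorm (h%:C *: x) = h * hnorm x.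
  by rewrite hnormZ normc_def /= expr0n addr0 sqrtr_sqr ger0_norm // invr_ge0.
have uB n x : hnorm (u n x) <= r * hnorm x.
  elim: n x => [|n IH] x; first by rewrite u0 hnorm0 mulr_ge0 ?hnorm_ge0.
  rewrite uS hh; have := ler_hnormD (B x) (u n (u n x)).
  have := hB x; have := IH x; have := IH (u n x); have := hnorm_ge0 (u n x).
  have := hnorm_ge0 x; rewrite /h; nra.
have uZ n : symmetric_op (u n).
  elim: n => [|n IH] x y; first by rewrite !u0 hdot0l hdot0r.
  by rewrite !uS hdotZl hdotZr_real !hdotDl !hdotDr sB !IH.
have uD n x : hnorm (u n.+1 x - u n x) <= hnorm x * r ^+ n.
  elim: n x => [|n IH] x.
    rewrite u0 subr0 uS u0 addr0 hh expr0 mulr1; have := hB x; have := hnorm_ge0 x.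
    rewrite /h; nra.
  have -> : u n.+2 x - u n.+1 x =
     h%:C *: (u n.+1 (u n.+1 x - u n x) + (u n.+1 (u n x) - u n (u n x))).
    rewrite [u n.+2 x]uS [u n.+1 x in X in _ - X]uS -scalerBr; congr (_ *: _).
    by rewrite (linearB (u n.+1)) addrA subrK opprD addrACA subrr add0r.
  rewrite hh; have := ler_hnormD (u n.+1 (u n.+1 x - u n x)) (u n.+1 (u n x) - u n (u n x)).
  have := uB n.+1 (u n.+1 x - u n x); have := IH x; have := IH (u n x); have := uB n x.
  rewrite exprS /h; have := exprn_ge0 n r0'; move: (r ^+ n) => q q0 h1 h2 h3 h4 h5.
  have h6 : hnorm (u n x) * q <= r * hnorm x * q by rewrite ler_wpM2r.
  have h7 : r * hnorm (u n.+1 x - u n x) <= r * (hnorm x * q) by rewrite ler_wpM2l.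
  by lra.
pose D (x : H) := hnorm x / (1 - r).
have /choice[g hg] x := geometric_cvg (hnorm_ge0 x) r0' r1 (uD^~ x).
have gl : linear g.
  move=> a x y; apply/subr0_eq.
  apply: (@hnorm_geometric0 _ _ _ (D (a *: x + y) + complex.Re `|a| * D x + D y) r) => // n.
  have -> : g (a *: x + y) - (a *: g x + g y) =
     (g (a *: x + y) - u n (a *: x + y)) + (a *: (u n x - g x) + (u n y - g y)).
    by rewrite (linearP (u n)) scalerBr [X in _ = _ + X]addrACA -opprD addrA subrK.
  apply: le_trans (ler_hnormD _ _) _.
  have := ler_hnormD (a *: (u n x - g x)) (u n y - g y).
  have := hg (a *: x + y) n; have := hg x n; have := hg y n.
  rewrite hnormZ (hnorm_distC (g _)) -/(D _) -/(D _) -/(D _) => h1 h2 h3 h4.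
  have a0 : 0 <= complex.Re `|a| by have := normr_ge0 a; rewrite lecE => /andP[].
  have := ler_wpM2l a0 h2; lra.
have gB x : hnorm (g x) <= r * hnorm x.
  apply: (@le_geometric _ _ _ (D x) r) => // n.
  have := ler_hnormD (g x - u n x) (u n x); rewrite subrK hnorm_distC.
  have := hg x n; have := uB n x; rewrite -/(D x); lra.
exists (mk_bop gl gB); split=> [x y|//|x] /=.
- have le_sym x' y' : complex.Re (hdot (g x') y') <= complex.Re (hdot x' (g y')).
    apply: (@le_geometric _ _ _ (D x' * hnorm y' + D y' * hnorm x') r) => // n.
    have := Re_hdot_le (g x' - u n x') y'; have := Re_hdot_le (u n y' - g y') x'.
    rewrite hnorm_distC (hnorm_distC (g x')) !hdotBl !raddfB /= uZ Re_hdotC [X in _ - X]Re_hdotC.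
    rewrite (hnorm_distC (g y')).
    have := hg x' n; have := hg y' n; rewrite -/(D _) -/(D _) => h1 h2 h3 h4.
    have := ler_wpM2r (hnorm_ge0 x') h1; have := ler_wpM2r (hnorm_ge0 y') h2; lra.
  move: x; apply: Re_linear_ext => x; [|by rewrite hdotZl|].
    suff -> : g ('i *: x) = 'i *: g x by rewrite hdotZl.
    by rewrite -[g ('i *: x)]/(mk_bop gl gB ('i *: x)) linearZ.
  by apply/eqP; rewrite eq_le le_sym Re_hdotC [leRHS]Re_hdotC le_sym.
apply/subr0_eq.
apply: (@hnorm_geometric0 _ _ _ (2 * D x * r + r * D x + D (g x)) r) => // n.
(* Twice the recursion reads 2 u_(n+1) x = B x + u_n (u_n x); the three errors
   of replacing u by g in it are geometric. *)
have -> : g x + g x - (B x + g (g x)) =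
   (g x - u n.+1 x) + (g x - u n.+1 x) + (u n (u n x - g x) + (u n (g x) - g (g x))).
  have -> : u n (u n x - g x) + (u n (g x) - g (g x)) = u n (u n x) - g (g x).
    by rewrite linearB addrA subrK.
  have E : u n.+1 x + u n.+1 x = B x + u n (u n x).
    rewrite uS -scalerDl -rmorphD (_ : h + h = 1) /h /=; last by field.
    by rewrite scale1r.
  by rewrite [X in _ = X + _]addrACA -opprD E !opprD -!addrA addKr.
apply: le_trans (ler_hnormD _ _) _.
have := ler_hnormD (g x - u n.+1 x) (g x - u n.+1 x).
have := ler_hnormD (u n (u n x - g x)) (u n (g x) - g (g x)).
have := hg x n.+1; have := hg x n; have := hg (g x) n; have := uB n (u n x - g x).
rewrite (hnorm_distC (g x)) exprS -/(D _) -/(D _) => h1 h2 h3 h4 h5 h6.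
have := ler_wpM2l r0' h3; lra.
Qed.

(** With c large, B = I - A/c has norm at most r = 1 - 1/c, and the fixed point
    Y = (B + Y^2)/2 satisfies (I - Y)^2 = I - B = A/c. *)
Lemma coercive_sqrt A : positive_op A ->
  (forall x, hnorm x ^+ 2 <= complex.Re (hdot (A x) x)) ->
  positive_op (op_sqrt A) /\ op_sqrt A \cmp op_sqrt A = A.
Proof.
move=> pA cA; have sA := positive_symmetric pA.
suff [B hB] : exists B : bop H H, positive_op B /\ B \cmp B = A.
  have := @xgetPex _ 0 [set B : bop H H | positive_op B /\ B \cmp B = A].
  by apply; exists B.
have [M M0 hM] := bop_bounded A.
(* Any bound of A larger than 1 would do: it makes r lie strictly between
   0 and 1. *)
pose c := M + 2; pose r := 1 - c^-1.
have c0 : 0 < c by rewrite /c; lra.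
have c1 : c^-1 < 1 by rewrite invf_lt1 // /c; lra.
have c2 : 0 < c^-1 by rewrite invr_gt0.
have r0 : 0 < r by rewrite subr_gt0.
have r1 : r < 1 by rewrite /r; lra.
pose B := bid H - (c^-1)%:C *: A.
have BE x : B x = x - (c^-1)%:C *: A x by [].
have sB : symmetric_op B.
  by move=> x y; rewrite !BE hdotBl hdotBr hdotZl hdotZr_real sA.
have hB x : hnorm (B x) <= r * hnorm x.
  move: x; apply: symmetric_norm_le => // x.
  have -> : complex.Re (hdot (B x) x) = hnorm x ^+ 2 - c^-1 * complex.Re (hdot (A x) x).
    by rewrite BE hdotBl hdotZl hdot_diagE; case: (hdot (A x) x) => ? ? /=; ring.
  have h1 : c^-1 * complex.Re (hdot (A x) x) <= hnorm x ^+ 2.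
    rewrite mulrC ler_pdivrMr //; apply: le_trans (Re_hdot_le _ _) _.
    have := hM x; have := hnorm_ge0 x; have := sqr_ge0 (hnorm x); rewrite /c; nra.
  have h2 : c^-1 * hnorm x ^+ 2 <= c^-1 * complex.Re (hdot (A x) x).
    by rewrite ler_wpM2l ?cA // ltW.
  by apply/andP; split; rewrite /r; lra.
have [Y [sY hY fY]] := half_fixpoint sB r0 r1 hB.
pose s := Num.sqrt c.
have ss : s * s = c by rewrite -expr2 sqr_sqrtr // ltW.
pose X := s%:C *: (bid H - Y).
have XE x : X x = s%:C *: (x - Y x) by [].
exists X; split.
  apply: symmetric_positive => [x y|x].
    by rewrite !XE hdotZl hdotZr_real hdotBl hdotBr sY.
  rewrite XE dot_ReZ mulr_ge0 ?sqrtr_ge0 // hdotBl raddfB /= -hnorm_sqr subr_ge0.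
  apply: le_trans (Re_hdot_le _ _) _; have := hY x; have := hnorm_ge0 x; nra.
apply: bop_ext => x; have -> : (X \cmp X) x = X (X x) by [].
have YE : Y (s%:C *: (x - Y x)) = s%:C *: (Y x - Y (Y x)) by rewrite linearZ linearB.
rewrite !XE YE -scalerBr scalerA -rmorphM ss opprB.
have -> : x - Y x + (Y (Y x) - Y x) = (c^-1)%:C *: A x.
  have -> : Y (Y x) = Y x + Y x - B x by rewrite fY addrC addKr.
  by rewrite [_ + _ - B x - _]addrAC addrK addrA subrK BE subKr.
by rewrite scalerA -rmorphM /= mulfV ?gt_eqF // scale1r.
Qed.

End SquareRoot.

(** * Totality and minimality *)

Section ClosedSubspaces.
Variables (R : realType) (H : hilbertType R).

(** The adjoint of the inclusion of M is the orthogonal projection, so p minus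
    its projection is orthogonal to M. *)
Lemma closed_subspace_total (M : closed_subspace H) :
  (forall p : H, (forall q, cs_set M q -> hdot p q = 0) -> p = 0) ->
  forall p, cs_set M p.
Proof.
move=> h p; have -> : p = val (adj (csub_incl M) p).
  apply/subr0_eq/h => q Mq; rewrite hdotC.
  have qM : cs_pred M q by rewrite /cs_pred in_setE.
  have e : hdot q p = hdot q (val (adj (csub_incl M) p)).
    exact: (hdot_adj (csub_incl M) (Csub qM) p).
  by rewrite hdotBr e subrr /= oppr0.
by have := cs_valP (adj (csub_incl M) p); rewrite /cs_pred in_setE.
Qed.

Lemma hnorm_val (M : closed_subspace H) (x : csub M) : hnorm (val x) = hnorm x.
Proof. by apply/eqP; rewrite -(@eqrXn2 _ 2) ?hnorm_ge0 // !hnorm_sqr. Qed.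

(** A vector orthogonal to a closed subspace containing the orbit of V is
    orthogonal to the orbit, hence zero. *)
Lemma minimal_total (K : hilbertType R) (V : bop K H) (S : bop H H) :
  (forall p, (forall n h, hdot p (iter n S (V h)) = 0) -> p = 0) -> minimal V S.
Proof.
move=> h; apply/seteqP; split=> // p _ M /= hM.
apply: closed_subspace_total => {}p hp; apply: h => n x; apply/hp/hM.
by exists n => //; exists x.
Qed.

End ClosedSubspaces.

(** * Shifts on square summable sequences *)

Section SquareSummable.
Variables (R : realType) (L : hilbertType R).

Lemma lim_series_single (v : nat -> R) n :
  (forall k, k != n -> v k = 0) -> limn (series v) = v n.
Proof.
move=> h; apply/cvg_lim => //; apply: cvg_near_cst.
exists n.+1 => // N /= nN; rewrite /series /= big_mkord (bigD1 (Ordinal nN)) //=.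
by rewrite big1 ?addr0 // => i; rewrite -val_eqE /= => /h.
Qed.

Lemma iter_fshift_inj0 n (y : L) k :
  iter n (fshift L) (inj0 L y) k = if k == n then y else 0.
Proof. by elim: n k => [|n IH] [|k] //=. Qed.

(** S_+^n J y is the sequence with y at place n, so pairing with it extracts a
    coordinate. *)
Lemma hdot_iter_fshift n (x : ell2 L) (y : L) :
  hdot x (iter n (fshift L) (inj0 L y)) = hdot (x n) y.
Proof.
set z := iter _ _ _.
have zk k : k != n -> hdot (x k) (z k) = 0.
  by move=> /negbTE kn; rewrite /z iter_fshift_inj0 kn hdot0r.
rewrite [LHS]/(csum (fun k => hdot (x k) (z k))) /csum.
rewrite !(@lim_series_single _ n); try by move=> k /zk ->.
by rewrite /z iter_fshift_inj0 eqxx; case: (hdot _ _).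
Qed.

(** Orthogonality of the ranges of S_+ and J, in the form in which both the norm
    of S_{A,T} and the unitarity of the identification with l^2(H) use it. *)
Lemma hnorm_fshift_inj0 (x : ell2 L) (y : L) :
  hnorm (fshift L x + inj0 L y) ^+ 2 = hnorm x ^+ 2 + hnorm y ^+ 2.
Proof.
rewrite !ell2_hnorm; apply/cvg_lim => //; rewrite -cvg_shiftS /=.
have /asboolP cx := ell2_valP x.
have : (fun n => hnorm y ^+ 2 + series (fun k => hnorm (x k) ^+ 2) n) @ \oo -->
   hnorm y ^+ 2 + limn (series (fun k => hnorm (x k) ^+ 2)).
  by apply: cvgD => //; exact: cvg_cst.
rewrite addrC; set f := (X in X @ _ --> _ -> _); set g := (X in _ -> X @ _ --> _).
suff -> : g = f by [].
apply/funext => n; rewrite /f /g.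
rewrite /series /= big_nat_recl //; congr (_ + _).
  by congr (hnorm _ ^+ 2); exact: add0r.
by apply: eq_bigr => k _; congr (hnorm _ ^+ 2); exact: addr0.
Qed.

Lemma hnorm_ell2_eq (L' : hilbertType R) (x : ell2 L) (x' : ell2 L') :
  (forall n, hnorm (x n) = hnorm (x' n)) -> hnorm x = hnorm x'.
Proof.
move=> h; apply/eqP; rewrite -(@eqrXn2 _ 2) ?hnorm_ge0 // !ell2_hnorm.
by apply/eqP; congr (limn (series _)); apply/funext => n; rewrite h.
Qed.

End SquareSummable.

(** * Liftings and unitary equivalence *)

Section Transport.
Variables (R : realType) (H K K' : hilbertType R).

Lemma isometric_hdot (V : bop H K) x y : isometric V -> hdot (V x) (V y) = hdot x y.
Proof. by move=> hV; rewrite hdot_adj -[adj V (V y)]/((adj V \cmp V) y) hV. Qed.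

Lemma unitary_surjective (U : bop K K') : isometric U ->
  (forall y, exists x, U x = y) -> unitary U.
Proof.
move=> iU sU; split=> //; apply: bop_ext => y; have [x <-] := sU y.
by rewrite -[LHS]/(U ((adj U \cmp U) x)) iU.
Qed.

(** All the properties are invariant under the unitary equivalence
    S |-> U S U^*.  Minimality is assumed as totality of the vectors S^n V h,
    which passes through U^* directly. *)
Lemma transport_lifting (U : bop K K') (V : bop H K) (T : bop H H) (S : bop K K) :
  unitary U -> lifting V T S -> two_isometry S ->
  (forall p, (forall n h, hdot p (iter n S (V h)) = 0) -> p = 0) ->
  type_I V S ->
  minimal_2isometric_lifting_type_I (U \cmp V) T (U \cmp S \cmp adj U).
Proof.
move=> [iU uU] [iV lS] tS mS tyS; set S' := U \cmp S \cmp adj U.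
have UK x : adj U (U x) = x by rewrite -[LHS]/((adj U \cmp U) x) iU.
have UK' x : U (adj U x) = x by rewrite -[LHS]/((U \cmp adj U) x) uU.
have S'E x : S' x = U (S (adj U x)) by [].
have aS' : adj S' = U \cmp adj S \cmp adj U.
  by apply: adj_unique => x y; rewrite S'E !hdot_adj adjK.
have aS'E x : adj S' x = U (adj S (adj U x)) by rewrite aS'.
have aVE x : adj (U \cmp V) x = adj V (adj U x) by rewrite adj_cmp.
have lSE x : adj V (S x) = T (adj V x) by rewrite -[LHS]/((adj V \cmp S) x) lS.
split.
- split; first by apply/isometricP => x; rewrite [LHS]((isometricP U).1 iU) (isometricP V).1.
  by apply: bop_ext => x; rewrite -[LHS]/(adj (U \cmp V) (S' x)) aVE S'E UK lSE -aVE.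
- apply: bop_ext => x.
  rewrite -[LHS]/(adj S' (adj S' (S' (S' x))) - (adj S' (S' x)) *+ 2 + x).
  rewrite !aS'E !S'E !UK -linearMn -linearB -[X in _ + X]UK' -linearD.
  have := congr1 (fun C : bop K K => C (adj U x)) tS.
  by rewrite -[LHS]/(adj S (adj S (S (S (adj U x)))) - (adj S (S (adj U x))) *+ 2 + adj U x)
    => ->; rewrite linear0.
- apply: minimal_total => p hp; rewrite -[p]UK' (mS (adj U p)) ?linear0 // => n h.
  have e : iter n S' (U (V h)) = U (iter n S (V h)).
    by elim: n => // n IH; rewrite iterS IH S'E UK.
  by rewrite -hdot_adjr -e; exact: hp.
- move=> x hx; have dE : Delta S' x = U (Delta S (adj U x)).
    have -> : Delta S' x = adj S' (S' x) - x by [].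
    by rewrite aS'E S'E !UK -[X in _ - X]UK' -linearB.
  by rewrite dE tyS ?linear0 // => h; rewrite -hdot_adjr hx.
Qed.

(** The 2-isometry identity as an identity between Gram forms, whose terms are
    computable from the form of S alone. *)
Lemma two_isometry_gram (S : bop K K) :
  (forall p q, hdot (S (S p)) (S (S q)) - 2 * hdot (S p) (S q) + hdot p q = 0) ->
  two_isometry S.
Proof.
move=> h; apply: bop_ext => p; apply: hdot_ext => q.
have -> : (adj S \cmp adj S \cmp S \cmp S - (adj S \cmp S) *+ 2 + bid K) p =
  adj S (adj S (S (S p))) - adj S (S p) *+ 2 + p by [].
rewrite mulr2n hdotDl hdotBl hdotDl -!hdot_adjr hdot0l -(h p q); ring.
Qed.

End Transport.

(** * The operator S_{A,T} when A_T is at least the identity *)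

Section Construction.
Variables (R : realType) (H : hilbertType R) (A T : bop H H).
Hypothesis pA : positive_op A.
Hypothesis invA : adj T \cmp A \cmp T = A.
Hypothesis geI : op_le (bid H) (A_sub A T).

Local Notation D := (A_sub A T).
Local Notation M := (range_closure D).
Local Notation L := (defect_space A T).
Local Notation S := (S_op A T).

Lemma A_sub_coercive x : hnorm x ^+ 2 <= complex.Re (hdot (D x) x).
Proof.
have := geI x; have -> : hdot ((D - bid H) x) x = hdot (D x) x - hdot x x.
  by rewrite -hdotBl.
by rewrite lecE => /andP[_]; rewrite raddfB /= -hnorm_sqr subr_ge0.
Qed.

Lemma A_sub_positive : positive_op D.
Proof.
move=> x; have e : (D - bid H) x + x = D x by exact: subrK.
rewrite -e hdotDl.
by rewrite addr_ge0 ?geI ?dnorm_ge0.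
Qed.

(** A_T is bounded below by I, so A_T x = y is the Euler equation of
    <A_T x, x> - 2 Re <x, y>. *)
Lemma A_sub_surjective y : exists x, D x = y.
Proof.
have [|u|a u v|u|x hx] := @lax_milgram _ _ D (fun x => hdot x y) (hnorm y).
- exact/positive_symmetric/A_sub_positive.
- exact: A_sub_coercive.
- by rewrite hdotDl hdotZl.
- by rewrite mulrC; exact: Re_hdot_le.
- by exists x; apply: hdot_extr => z; rewrite -hx.
Qed.

(** Already the range of A_T is everything; the identification of
    l^2(defect space) (+) H with l^2(H) depends on it. *)
Lemma defect_full x : cs_set M x.
Proof. by have [z <-] := A_sub_surjective x; apply: subset_closure; exists z. Qed.

Lemma defect_memP x : cs_pred M x.
Proof. by rewrite /cs_pred in_setE; exact: defect_full. Qed.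

Let sqrtP := coercive_sqrt A_sub_positive A_sub_coercive.

(** The projection onto the defect space is the identity, as that space is
    everything. *)
Lemma val_A_sub_sqrt h : val (A_sub_sqrt A T h) = op_sqrt D h.
Proof.
apply: hdot_extr => q.
exact/esym/(hdot_adj (csub_incl M) (Csub (defect_memP q)) (op_sqrt D h)).
Qed.

(** The square of A_T^{1/2} is already surjective. *)
Lemma A_sub_sqrt_surjective (y : L) : exists h, A_sub_sqrt A T h = y.
Proof.
have [x xy] := A_sub_surjective (val y); exists (op_sqrt D x).
by apply: val_inj; rewrite val_A_sub_sqrt -xy -[in RHS]sqrtP.2.
Qed.

(** The right-hand side is <A_T h, h> written out. *)
Lemma hnorm_A_sub_sqrt h : hnorm (A_sub_sqrt A T h) ^+ 2 =
  complex.Re (hdot (A h) h) - hnorm (T h) ^+ 2 + hnorm h ^+ 2.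
Proof.
have -> : hnorm (A_sub_sqrt A T h) ^+ 2 = complex.Re (hdot (D h) h).
  rewrite hnorm_sqr -[hdot _ _]/(hdot (val (A_sub_sqrt A T h)) (val (A_sub_sqrt A T h))).
  rewrite val_A_sub_sqrt -(positive_symmetric sqrtP.1).
  by rewrite -[op_sqrt D (op_sqrt D h)]/((op_sqrt D \cmp op_sqrt D) h) sqrtP.2.
have -> : D h = A h - (adj T (T h) - h) by [].
rewrite !hdotBl -hdot_adjr !raddfB /= -!hnorm_sqr; ring.
Qed.

Lemma S_opE x h : S (x, h) = (fshift L x + inj0 L (A_sub_sqrt A T h), T h).
Proof.
have -> : S (x, h) = (fshift L x + inj0 L (A_sub_sqrt A T h) + 0,
  0 + ((0 : bop _ _) x + T h)) by [].
by rewrite addr0 [_ + T h]add0r add0r.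
Qed.

(** Delta_S = 0 (+) A, from which the 2-isometry identity, type I and the value
    of the covariance all follow. *)
Lemma Delta_S_op : Delta S = hinr _ _ \cmp A \cmp hsnd (ell2 L) H.
Proof.
apply/subr0_eq/numerical_range0 => -[x h]; set E := _ \cmp hsnd _ _.
have -> : hdot ((Delta S - E) (x, h)) (x, h) =
    hdot (adj S (S (x, h)) - (x, h)) (x, h) - hdot (E (x, h)) (x, h).
  by rewrite -hdotBl.
have -> : hdot (E (x, h)) (x, h) = hdot (A h) h.
  (* The inner product of the direct sum unfolds to a sum, whose first term here
     is hdot 0 x. *)
  by rewrite -[RHS]add0r -(hdot0l x).
rewrite hdotBl -hdot_adjr !hdot_diagE !hsum_hnorm S_opE /=.
rewrite hnorm_fshift_inj0 hnorm_A_sub_sqrt.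
have := pA h; rewrite lecE; case: (hdot (A h) h) => a b /= /andP[/eqP -> _].
apply/eqP; rewrite eq_complex /=; apply/andP; split; apply/eqP; ring.
Qed.

Lemma Delta_S_opE p : Delta S p = (0, A p.2).
Proof. by rewrite Delta_S_op. Qed.

Lemma S_op_gram p q : hdot (S p) (S q) = hdot p q + hdot (A p.2) q.2.
Proof.
rewrite hdotC hdot_adj -hdotC.
have -> : adj S (S p) = p + Delta S p by rewrite addrC [RHS]subrK.
rewrite Delta_S_opE hdotDl; congr (_ + _).
by rewrite -[RHS]add0r -(hdot0l q.1).
Qed.

(** Since T^* A T = A, the correction term <A p.2, q.2> of [S_op_gram] takes the
    same value at (S p, S q) as at (p, q). *)
Lemma S_op_two_isometry : two_isometry S.
Proof.
apply: two_isometry_gram => p q.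
have invAE u v : hdot (A (T u)) (T v) = hdot (A u) v.
  by rewrite hdot_adjr -[in RHS]invA.
rewrite !S_op_gram.
have S2 u : (S u).2 = T u.2 by case: u => x h; rewrite S_opE.
by rewrite !S2 invAE; ring.
Qed.

Lemma S_op_lifting : lifting (hinr (ell2 L) H) T S.
Proof.
have aV : adj (hinr (ell2 L) H) = hsnd (ell2 L) H.
  by apply: adj_unique => x y; rewrite -[RHS]add0r -(hdot0l y.1).
split; last by rewrite aV; apply: bop_ext => -[x h]; rewrite -[LHS]/((S (x, h)).2) S_opE.
apply/isometricP => h; apply/eqP; rewrite -(@eqrXn2 _ 2) ?hnorm_ge0 // hsum_hnorm.
by rewrite /= hnorm0 expr0n add0r.
Qed.

Lemma iter_S_opl n x : iter n S (x, 0) = (iter n (fshift L) x, 0).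
Proof.
elim: n => // n IH; rewrite !iterS IH S_opE !linear0.
by rewrite addr0.
Qed.

(** As S(0,h) = (J A_T^{1/2} h, 0) + (0, T h), a vector orthogonal to all S^n(0,h)
    is orthogonal to S^n (J A_T^{1/2} h, 0) = (S_+^n J A_T^{1/2} h, 0), so its
    n-th coordinate is orthogonal to the range of A_T^{1/2}, which is full. *)
Lemma S_op_total p :
  (forall n h, hdot p (iter n S (hinr (ell2 L) H h)) = 0) -> p = 0.
Proof.
case: p => x h0 hp.
have h00 : h0 = 0.
  by apply: hdot_ext => h; rewrite hdot0l -(hp 0%N h) -[LHS]add0r -(hdot0r x).
suff x0 : x = 0 by rewrite x0 h00.
apply: val_inj; apply/funext => n; apply: hdot_ext => y; rewrite hdot0l.
have [h <-] := A_sub_sqrt_surjective y; rewrite -hdot_iter_fshift.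
have := hp n.+1 h; rewrite iterSr.
have -> : S (hinr (ell2 L) H h) = (inj0 L (A_sub_sqrt A T h), 0) + hinr (ell2 L) H (T h).
  by rewrite S_opE linear0 add0r; congr pair; rewrite ?addr0 ?add0r.
have iterD k a b : iter k S (a + b) = iter k S a + iter k S b.
  by elim: k => // k IH; rewrite !iterS IH linearD.
rewrite iterD hdotDr hp addr0 iter_S_opl.
by move=> <-; rewrite -[LHS]addr0 -(hdot0r h0).
Qed.

Lemma S_op_type_I : type_I (hinr (ell2 L) H) S.
Proof.
move=> [x h] hx; rewrite Delta_S_opE /=.
have -> : h = 0; last by rewrite linear0.
by apply: hdot_ext => k; rewrite hdot0l -(hx k) -[LHS]add0r -(hdot0r x).
Qed.

Lemma cov_S_op : cov S = Num.sqrt (opnorm A).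
Proof.
rewrite /cov; congr (Num.sqrt (sup _)).
have hE (y : H) : hnorm ((0, y) : hsum (ell2 L) H) = hnorm y.
  by have [iV _] := S_op_lifting; exact: ((isometricP _).1 iV y).
apply/seteqP; split=> _ [p p1 <-].
  exists p.2; last by rewrite Delta_S_opE hE.
  by apply: le_trans p1; have := hsnd_bound p; rewrite mul1r.
exists ((0, p) : hsum (ell2 L) H); last by rewrite Delta_S_opE hE.
by rewrite /= hE.
Qed.

(** Norms are preserved by [hnorm_fshift_inj0], and the map is onto because every
    vector of H lies in the defect space. *)
Lemma ell2_ident_unitary : unitary (ell2_ident M).
Proof.
have UE x h : ell2_ident M (x, h) = fshift H (ell2_map (csub_incl M) x) + inj0 H h by [].
apply: unitary_surjective.
  apply/isometricP => -[x h]; apply/eqP; rewrite -(@eqrXn2 _ 2) ?hnorm_ge0 //.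
  rewrite UE hnorm_fshift_inj0 hsum_hnorm /=.
  by rewrite (@hnorm_ell2_eq _ _ _ _ x) // => n; exact: hnorm_val.
move=> y.
have [x xE] : exists x : nat -> csub M, forall n, val (x n) = y n.+1.
  by exists (fun n => Csub (defect_memP (y n.+1))).
have [N|sx _] := @sq_summable_bound _ _ x (hnorm y ^+ 2).
  rewrite ell2_hnorm; apply: le_trans (ell2_partial_le y N.+1).
  rewrite [leRHS]big_nat_recl //= -[leLHS]add0r lerD ?sqr_ge0 //.
  by apply: ler_sum => k _; rewrite -xE hnorm_val.
exists (Ell2 sx, y 0%N); rewrite UE; apply: val_inj; apply/funext => -[|n].
  exact: add0r.
by apply: etrans (xE n); exact: addr0.
Qed.

Lemma S_op_lifts_ge1 : S_op_lifts A T.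
Proof.
split.
- by split=> //; exact: A_sub_positive.
- exact: ell2_ident_unitary.
- split; [exact: S_op_lifting|exact: S_op_two_isometry| |exact: S_op_type_I].
  by apply: minimal_total; exact: S_op_total.
- apply: transport_lifting; [exact: ell2_ident_unitary|exact: S_op_lifting
    |exact: S_op_two_isometry|exact: S_op_total|exact: S_op_type_I].
Qed.

(** Under the identification, the summand H becomes the zeroth coordinate of
    l^2(H). *)
Lemma ell2_ident_hinr : ell2_ident M \cmp hinr _ H = inj0 H.
Proof.
apply: bop_ext => h.
have -> : (ell2_ident M \cmp hinr _ H) h = fshift H (ell2_map (csub_incl M) 0) + inj0 H h by [].
by rewrite !linear0 add0r.
Qed.

End Construction.

(** * The norm of T^* T *)

Section OperatorNorm.
Variables (R : realType) (H : hilbertType R).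
Implicit Types T : bop H H.

Lemma opnorm_has_sup T : has_sup [set hnorm (T x) | x in [set x | hnorm x <= 1]].
Proof.
split; first by exists (hnorm (T 0)), 0 => //=; rewrite hnorm0.
have [M M0 hM] := bop_bounded T; exists M => _ [y /= y1 <-].
by apply: le_trans (hM y) _; rewrite ler_piMr.
Qed.

Lemma opnorm_ge0 T : 0 <= opnorm T.
Proof.
apply: (sup_upper_bound (opnorm_has_sup T)).
by exists 0; rewrite /= ?linear0 hnorm0.
Qed.

Lemma hnorm_le_opnorm T x : hnorm (T x) <= opnorm T * hnorm x.
Proof.
have [x0|xN0] := eqVneq (hnorm x) 0.
  by rewrite (hnorm_eq0 x0) linear0 hnorm0 mulr0.
have gt0 : 0 < hnorm x by rewrite lt_def xN0 hnorm_ge0.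
have nZ y : hnorm ((hnorm x)^-1%:C *: y) = (hnorm x)^-1 * hnorm y.
  rewrite hnormZ normc_def /= expr0n addr0 sqrtr_sqr ger0_norm //.
  by rewrite invr_ge0 ltW.
rewrite -ler_pdivrMr // mulrC -nZ -linearZ.
apply: (sup_upper_bound (opnorm_has_sup T)); exists ((hnorm x)^-1%:C *: x) => //=.
by rewrite nZ mulVf.
Qed.

Lemma opnorm_le T (c : R) :
  (forall x, hnorm x <= 1 -> hnorm (T x) <= c) -> opnorm T <= c.
Proof.
move=> h; apply: ge_sup => [|_ [x /= x1 <-]]; last exact: h.
by exists (hnorm (T 0)), 0 => //=; rewrite hnorm0.
Qed.

(** The C*-identity: both bounds come from |T x|^2 = <x, T^* T x>, resp. from
    |y|^2 = <T x, T y> for y = T^* T x. *)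
Lemma opnorm_gram T : opnorm (adj T \cmp T) = opnorm T ^+ 2.
Proof.
have T0 := opnorm_ge0 T; have G0 := opnorm_ge0 (adj T \cmp T).
apply/eqP; rewrite eq_le; apply/andP; split.
  apply: opnorm_le => x x1; set y := (_ \cmp _) x.
  have [->|yN0] := eqVneq (hnorm y) 0; first exact: sqr_ge0.
  have gt0 : 0 < hnorm y by rewrite lt_def yN0 hnorm_ge0.
  rewrite -(ler_pM2r gt0) -[leLHS]expr2 hnorm_sqr {1}/y /= -hdot_adjr.
  apply: le_trans (Re_hdot_le _ _) _.
  rewrite expr2 -mulrA ler_pM ?hnorm_ge0 ?hnorm_le_opnorm //.
  by apply: le_trans (hnorm_le_opnorm T x) _; rewrite ler_piMr.
rewrite -[leRHS]sqr_sqrtr // ler_pXn2r ?nnegrE ?sqrtr_ge0 //.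
apply: opnorm_le => x x1; rewrite -[leLHS]ger0_norm ?hnorm_ge0 // -sqrtr_sqr.
rewrite ler_wsqrtr // hnorm_sqr hdot_adj.
apply: le_trans (Re_hdot_le _ _) _; rewrite -[leRHS]mul1r.
rewrite ler_pM ?hnorm_ge0 //; apply: le_trans (hnorm_le_opnorm (adj T \cmp T) x) _.
by rewrite ler_piMr.
Qed.

End OperatorNorm.

(** * Operators similar to an isometry and quasi-isometries *)

Section Applications.
Variables (R : realType) (H : hilbertType R).
Implicit Types A T : bop H H.

(** A_T - I = A - T^* T = T^* (A - I) T. *)
Lemma A_sub_ge1 A T : op_le (bid H) A -> adj T \cmp A \cmp T = A ->
  op_le (bid H) (A_sub A T).
Proof.
move=> A1 invA x.
have -> : hdot ((A_sub A T - bid H) x) x = hdot (A x - (adj T (T x) - x) - x) x by [].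
have <- : hdot ((A - bid H) (T x)) (T x) = hdot (A x - (adj T (T x) - x) - x) x.
  have -> : (A - bid H) (T x) = A (T x) - T x by [].
  have -> : A x - (adj T (T x) - x) - x = A x - adj T (T x) by rewrite opprB addrA addrAC addrK.
  by rewrite !hdotBl -hdot_adjr (hdot_adjr T (A (T x))) -[in RHS]invA.
exact: A1.
Qed.

Lemma quasi_isometry_A_sub T : A_sub (adj T \cmp T) T = bid H.
Proof. by rewrite /A_sub /Delta opprB addrC subrK. Qed.

Lemma gram_positive (K : hilbertType R) (X : bop H K) : positive_op (adj X \cmp X).
Proof.
move=> x; have -> : (adj X \cmp X) x = adj X (X x) by [].
by rewrite -hdot_adjr dnorm_ge0.
Qed.

(** If T = Y V X with V isometric and Y the inverse of X, then X T = V X, so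
    A = X^* X is invariant; |x| = |Y X x| <= M |X x| bounds A from below. *)
Lemma similar_invariant T : similar_to_isometry T ->
  exists (A : bop H H) (b : R), [/\ positive_op A, 0 < b,
    adj T \cmp A \cmp T = A & op_le (b%:C *: bid H) A].
Proof.
move=> [K [V [X [Y [iV YX XY TE]]]]].
have [M M0 hM] := bop_bounded Y.
have b0 : 0 < M ^+ 2 + 1 by rewrite ltr_wpDl ?sqr_ge0.
have YXE x : Y (X x) = x by have := congr1 (fun C : bop H H => C x) YX.
have XTE x : X (T x) = V (X x).
  rewrite TE; have := congr1 (fun C : bop K K => C (V (X x))) XY.
  by [].
exists (adj X \cmp X), (M ^+ 2 + 1)^-1; split.
- exact: gram_positive.
- by rewrite invr_gt0.
- apply: bop_ext => x; apply: hdot_ext => y.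
  have -> : (adj T \cmp (adj X \cmp X) \cmp T) x = adj T (adj X (X (T x))) by [].
  have -> : (adj X \cmp X) x = adj X (X x) by [].
  by rewrite -!hdot_adjr !XTE isometric_hdot.
- move=> x; set b := (M ^+ 2 + 1)^-1.
  have -> : (adj X \cmp X - b%:C *: bid H) x = adj X (X x) - b%:C *: x by [].
  rewrite hdotBl hdotZl -hdot_adjr !hdot_diagE -rmorphM -rmorphB lecR subr_ge0.
  rewrite mulrC ler_pdivrMr //.
  have := hM (X x); rewrite YXE => h.
  have := hnorm_ge0 x; have := hnorm_ge0 (X x); have := sqr_ge0 (hnorm (X x)); nra.
Qed.

Lemma scaled_invariant A T (b : R) : 0 < b -> positive_op A ->
  adj T \cmp A \cmp T = A -> op_le (b%:C *: bid H) A ->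
  let A_b := (b^-1)%:C *: A in
  [/\ positive_op A_b, adj T \cmp A_b \cmp T = A_b & op_le (bid H) A_b].
Proof.
move=> b0 pA invA bA A_b.
have bi0 : 0 <= (b^-1)%:C :> R[i] by rewrite lecR invr_ge0 ltW.
split=> [x||x].
- by have -> : A_b x = (b^-1)%:C *: A x by []; rewrite hdotZl mulr_ge0.
- apply: bop_ext => x.
  have -> : (adj T \cmp A_b \cmp T) x = adj T ((b^-1)%:C *: A (T x)) by [].
  have -> : A_b x = (b^-1)%:C *: A x by [].
  by rewrite linearZ -[in RHS]invA.
- have e : (b^-1)%:C *: (A - b%:C *: bid H) x = (A_b - bid H) x.
    have -> : (A - b%:C *: bid H) x = A x - b%:C *: x by [].
    by rewrite scalerBr scalerA -rmorphM mulVf ?gt_eqF // scale1r.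
  by rewrite -e hdotZl mulr_ge0.
Qed.

Lemma S_op_exists A T : positive_op A -> adj T \cmp A \cmp T = A ->
  op_le (bid H) (A_sub A T) ->
  exists S : bop (ell2 H) (ell2 H), minimal_2isometric_lifting_type_I (inj0 H) T S.
Proof.
move=> pA invA geI; have [_ _ _ lift] := S_op_lifts_ge1 pA invA geI.
by eexists; rewrite -(ell2_ident_hinr A T); exact: lift.
Qed.

End Applications.

Theorem corollary3p12 (R : realType) (H : hilbertType R) (T : bop H H) :
  [/\ similar_to_isometry T \/ quasi_isometry T ->
        exists S : bop (ell2 H) (ell2 H),
          minimal_2isometric_lifting_type_I (inj0 H) T S,
      similar_to_isometry T ->
        (exists (A : bop H H) (b : R),
           [/\ positive_op A, 0 < b, adj T \cmp A \cmp T = A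
             & op_le (b%:C *: bid H) A]) /\
        (forall (A : bop H H) (b : R),
           positive_op A -> 0 < b -> adj T \cmp A \cmp T = A ->
           op_le (b%:C *: bid H) A ->
           let A_b := (b^-1)%:C *: A in
           S_op_lifts A_b T /\ cov (S_op A_b T) = Num.sqrt (opnorm A_b))
    & quasi_isometry T ->
        S_op_lifts (adj T \cmp T) T /\
        cov (S_op (adj T \cmp T) T) = opnorm T].
Proof.
have quasi1 : op_le (bid H) (A_sub (adj T \cmp T) T).
  by move=> x; rewrite quasi_isometry_A_sub subrr hdot0l.
have pG := gram_positive T.
split=> [[sT|qT]|sT|qT].
- have [A [b [pA b0 invA bA]]] := similar_invariant sT.
  have [pAb invAb Ab1] := scaled_invariant b0 pA invA bA.
  exact: (S_op_exists pAb invAb (A_sub_ge1 Ab1 invAb)).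
- exact: (S_op_exists pG qT quasi1).
- split=> [|A b pA b0 invA bA A_b]; first exact: similar_invariant.
  have [pAb invAb Ab1] := scaled_invariant b0 pA invA bA.
  have geI := A_sub_ge1 Ab1 invAb.
  by split; [exact: S_op_lifts_ge1|exact: cov_S_op].
- split; first exact: S_op_lifts_ge1.
  by rewrite cov_S_op // opnorm_gram sqrtr_sqr ger0_norm // opnorm_ge0.
Qed.
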